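(* Let $\Omega=\{x\in\mathbb{R}^3:|x|<1\}$, let $\Gamma=\partial\Omega$, and let $\underline{n}$ be the unit outward normal to $\Gamma$. Let $\mathcal{F}$ be the explicit family of vector fields $\underline{u}_0$ on $\overline{\Omega}$ given in spherical coordinates $(r,\theta,\varphi)$ by $$\underline{u}_0=-\frac{h(r)}{\sin\theta}\,\frac{\partial g}{\partial\varphi}\,\underline{e}_\theta+h(r)\,\frac{\partial g}{\partial\theta}\,\underline{e}_\varphi ,$$ where: - $h\in C^\infty([0,+\infty))$ is a real function vanishing in a neighborhood of $r=0$, with $h(1)+h'(1)=0$ and $h(1)\neq 0$; - $g=g(\theta,\varphi)\in C^\infty([0,\pi]\times\mathbb{R})$ is a real function, $2\pi$-periodic in $\varphi$, vanishing for $\theta$ in a neighborhood of $0$ and in a neighborhood of $\pi$ (for all $\varphi$); - with $G(\theta,\varphi)=\frac{\partial}{\partial\theta}\left(\sin\theta\,\frac{\partial g}{\partial\theta}\right)+\frac{1}{\sin\theta}\frac{\partial^2 g}{\partial\varphi^2}$, there is a point of $\Gamma$ at which $G\neq0$ and at least one of $\frac{\partial g}{\partial\varphi}\neq 0$, $\frac{\partial g}{\partial\theta}\neq0$ holds. Then every $\underline{u}_0\in\mathcal{F}$ is a $C^\infty(\overline{\Omega})$, divergence free vector field which satisfies the slip boundary conditions $\underline{u}_0\cdot\underline{n}=0$ and $(\mathrm{curl}\,\underline{u}_0)\times\underline{n}=0$ on $\Gamma$, and the following holds. Given $\underline{u}_0\in\mathcal{F}$, there exists $t_0>0$ such that the corresponding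 (unique, indefinitely differentiable) local solution $\underline{u}(t)$ to the Euler equations $$\partial_t\underline{u}+(\underline{u}\cdot\nabla)\underline{u}+\nabla\pi=0,\qquad \mathrm{div}\,\underline{u}=0,\qquad \underline{u}(0)=\underline{u}_0\qquad\text{in }\Omega,$$ under the zero flux boundary condition $\underline{u}\cdot\underline{n}=0$ on $\Gamma$, does not satisfy the boundary condition $\underline{\omega}(t)\times\underline{n}=0$ on $\Gamma$, where $\underline{\omega}=\mathrm{curl}\,\underline{u}$, for any $t\in(0,t_0]$.
   Context: Spherical coordinates: $r=|x|$ is the radius, $\theta\in[0,\pi]$ is the polar angle, $\varphi$ is the azimuthal angle, and $(\underline{e}_r,\underline{e}_\theta,\underline{e}_\varphi)$ is the associated positively oriented local orthonormal basis; on $\Gamma$ one has $\underline{n}=\underline{e}_r$. Points of $\Gamma$ are identified with their angular coordinates $(\theta,\varphi)$. Expressions involving $1/\sin\theta$ or $1/r$ and the functions $g$, $h$ are understood to be zero near the polar axis and near the origin, where $g$, respectively $h$, vanishes. The scalar function $\pi$ in the Euler equations is the pressure. ''Does not satisfy the boundary condition $\underline{\omega}(t)\times\underline{n}=0$ on $\Gamma$'' means that $\underline{\omega}(t)\times\underline{n}$ is not identically zero on $\Gamma$. *)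

(* Defs.v *)
From mathcomp Require Import all_boot all_order all_algebra.
From mathcomp Require Import all_classical all_reals all_analysis.

Set Implicit Arguments.
Unset Strict Implicit.
Unset Printing Implicit Defensive.

Import Order.TTheory GRing.Theory Num.Theory.
Import numFieldNormedType.Exports.

Local Open Scope classical_set_scope.
Local Open Scope ring_scope.

(* C^k and C^oo up to the boundary of an open set D: all iterated derivatives
   of order <= k exist in D and extend continuously to the closure of D.
   Values of f outside the closure of D are irrelevant; at the boundary no
   difference quotient of f is considered, only the continuous extension g of
   the interior derivative. *)
Fixpoint Ck_closure (R : realType) (V W : normedModType R) (D : set V)
    (k : nat) (f : V -> W) : Prop :=
  {within closure D, continuous f} /\
  (if k is k'.+1 then
     forall v : V, exists2 g : V -> W, Ck_closure D k' g &
       forall x, D x -> is_derive x v f (g x)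
   else True).

Definition Cinfty_closure (R : realType) (V W : normedModType R) (D : set V)
    (f : V -> W) : Prop :=
  forall k : nat, Ck_closure D k f.

(* Value at x, possibly a boundary point of D, of the continuous extension of
   the restriction of f to D. *)
Definition trace (R : realType) (V W : normedModType R) (D : set V)
    (f : V -> W) (x : V) : W :=
  lim (f y @[y --> within D (nbhs x)]).

Section VectorCalculus.
Variable R : realType.
Implicit Types (x v w : 'rV[R]_3) (u : 'rV[R]_3 -> 'rV[R]_3).

Definition vec3 (a b c : R) : 'rV[R]_3 := \row_(i < 3) [:: a; b; c]`_i.

Definition dot v w : R := \sum_(i < 3) v 0 i * w 0 i.

(* The norm `|x| of 'rV[R]_3 is the sup norm. *)
Definition enorm x : R := Num.sqrt (dot x x).

(* Indices are added modulo 3 in 'I_3. *)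
Definition cross v w : 'rV[R]_3 :=
  \row_(i < 3) (v 0 (i + 1) * w 0 (i + 2%:R) - v 0 (i + 2%:R) * w 0 (i + 1)).

Definition partial (W : normedModType R) (i : 'I_3) (f : 'rV[R]_3 -> W) x : W :=
  'D_(delta_mx 0 i) f x.

Definition grad (f : 'rV[R]_3 -> R) x : 'rV[R]_3 := \row_(i < 3) partial i f x.

Definition div u x : R := \sum_(i < 3) partial i (fun y => u y 0 i) x.

Definition curl u x : 'rV[R]_3 :=
  \row_(i < 3) (partial (i + 1) (fun y => u y 0 (i + 2%:R)) x
                - partial (i + 2%:R) (fun y => u y 0 (i + 1)) x).

(* (u . nabla) w *)
Definition advect u (w : 'rV[R]_3 -> 'rV[R]_3) x : 'rV[R]_3 :=
  \sum_(j < 3) u x 0 j *: partial j w x.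

Definition Omega : set 'rV[R]_3 := [set x | enorm x < 1].

Definition Gamma : set 'rV[R]_3 := [set x | enorm x = 1].

(* Unit outward normal to the unit sphere at x \in Gamma. *)
Definition normal x : 'rV[R]_3 := x.

Definition zero_flux u : Prop := forall x, Gamma x -> dot (u x) (normal x) = 0.

(* (curl u) x n = 0 on Gamma, with curl u extended continuously from Omega. *)
Definition vorticity_bc u : Prop :=
  forall x, Gamma x -> cross (trace Omega (curl u) x) (normal x) = 0.

(* u is a solution, smooth on [0, T] x closure Omega, with pressure p.  No
   regularity of p is needed beyond differentiability in x, since the equation
   makes its gradient smooth. *)
Definition euler_solution (u0 : 'rV[R]_3 -> 'rV[R]_3) (T : R)
    (u : R -> 'rV[R]_3 -> 'rV[R]_3) (p : R -> 'rV[R]_3 -> R) : Prop :=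
  [/\ Cinfty_closure (`]0, T[%classic `*` Omega)
        (fun z : R * 'rV[R]_3 => u z.1 z.2),
      forall (t : R) x, 0 < t < T -> Omega x -> differentiable (p t) x,
      forall (t : R) x, 0 < t < T -> Omega x ->
        'D_1 (fun s => u s x) t + advect (u t) (u t) x + grad (p t) x = 0
        /\ div (u t) x = 0,
      forall x, Omega x -> u 0 x = u0 x &
      forall t : R, 0 <= t <= T -> zero_flux (u t)].

End VectorCalculus.

Section SlipFamily.
Variable R : realType.
Implicit Types (h : R -> R) (g : R * R -> R).

Definition spherical (r theta phi : R) : 'rV[R]_3 :=
  vec3 (r * sin theta * cos phi) (r * sin theta * sin phi) (r * cos theta).

Definition e_theta (theta phi : R) : 'rV[R]_3 :=
  vec3 (cos theta * cos phi) (cos theta * sin phi) (- sin theta).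

Definition e_phi (phi : R) : 'rV[R]_3 := vec3 (- sin phi) (cos phi) 0.

Definition d_theta g (theta phi : R) : R := 'D_(1, 0) g (theta, phi).

Definition d_phi g (theta phi : R) : R := 'D_(0, 1) g (theta, phi).

Definition G_of g (theta phi : R) : R :=
  d_theta (fun z => sin z.1 * d_theta g z.1 z.2) theta phi
  + (sin theta)^-1 * d_phi (fun z => d_phi g z.1 z.2) theta phi.

Definition radial_profile h : Prop :=
  [/\ @Cinfty_closure R R R `]0, +oo[%classic h,
      exists2 d : R, 0 < d & forall r : R, 0 <= r < d -> h r = 0,
      h 1 + derive1 h 1 = 0 &
      h 1 != 0].

(* The nondegeneracy point is sought with 0 < theta < pi, since near the poles
   all derivatives of g, and G, are zero. *)
Definition angular_profile g : Prop :=
  [/\ @Cinfty_closure R (R * R)%type R (`]0, pi[%classic `*` [set: R]) g,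
      forall theta phi : R, 0 <= theta <= pi ->
        g (theta, phi + 2 * pi) = g (theta, phi),
      exists2 d : R, 0 < d & forall theta phi : R, 0 <= theta <= pi ->
        theta < d \/ pi - d < theta -> g (theta, phi) = 0 &
      exists theta phi : R, [/\ 0 < theta < pi, G_of g theta phi != 0 &
        d_phi g theta phi != 0 \/ d_theta g theta phi != 0]].

(* The spherical formula off the polar axis.  The axis is treated separately:
   the expression in g is zero there because g vanishes near theta = 0, pi.
   Values of u0 outside the closed unit ball are irrelevant. *)
Definition slip_field h g (u0 : 'rV[R]_3 -> 'rV[R]_3) : Prop :=
  (forall r theta phi : R, 0 <= r <= 1 -> 0 < theta < pi ->
     u0 (spherical r theta phi) =
       - (h r / sin theta * d_phi g theta phi) *: e_theta theta phi
       + (h r * d_theta g theta phi) *: e_phi phi)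
  /\ (forall z : R, -1 <= z <= 1 -> u0 (vec3 0 0 z) = 0).

Definition slip_family (u0 : 'rV[R]_3 -> 'rV[R]_3) : Prop :=
  exists h g, [/\ radial_profile h, angular_profile g & slip_field h g u0].

End SlipFamily.

(* Main.v *)
From HB Require Import structures.
Require Import Defs.
From mathcomp Require Import all_boot all_order all_algebra.
From mathcomp Require Import all_classical all_reals all_analysis.
From mathcomp Require Import ring lra.
Import Order.TTheory GRing.Theory Num.Theory.
Import numFieldNormedType.Exports.
Local Open Scope classical_set_scope.
Local Open Scope ring_scope.

Set Implicit Arguments.
Unset Strict Implicit.
Unset Printing Implicit Defensive.

(** Let [M] be the Jacobian of the velocity and [A = M - M^T], so that
    [A v = curl u \times v].  The datum extends to a smooth field [U] on the whole
    space with [U x . x = 0], whence [M^T x = - U x]; on the sphere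
    [h 1 + h' 1 = 0] gives [M x = - U x], so [A x = 0], which is the slip
    condition at time zero.  Taking the curl of the Euler equation removes the
    pressure and gives [d_t A = - (M^2 - (M^2)^T) - (U . grad) A]; differentiating
    [A x = 0] along the tangent vector [U x] then yields [(d_t A) x = 2 A U] at
    time zero on the sphere.  Since [A x = 0] and
    [sin theta * e_phi . A e_theta = h 1 * G], [A U] is nonzero where [G] and the
    gradient of [g] are.  There [curl u \times n] vanishes at time zero with a
    nonzero time derivative, hence does not vanish for small [t > 0].  As the
    solution is only known to have derivatives that extend continuously to the
    boundary, mean value estimates are made inside and passed to the limit. *)

(** * Differentiation along segments *)

(** [M x = - U x] holds on the sphere because [U] is proportional to [h] along each ray, so that its
    radial derivative there is [h' 1 / h 1] times [U]. The factor 2 has two equal sources: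
    [- (M^2 - (M^2)^T) x = M U - M^T U = A U], and the slip condition [A y = 0], differentiated
    along [U], gives [- ((U . grad) A) x = A U]. Being antisymmetric with [A x = 0], the matrix [A]
    acts on the tangent plane as a quarter turn times the radial vorticity, which off the poles is a
    nonzero multiple of [G]; hence [A U] can vanish there only with [G] or with [U].

    The obstacle is that the initial face and the lateral boundary both bound the space-time
    cylinder: no derivative of the solution is available there, only extensions of interior
    derivatives, which have to be identified with derivatives of [U]. This is why the datum is first
    made globally smooth, and why limits are taken along rays of direction [(1, - x)], which enter
    the cylinder from both faces at once. *)

Section LineCalculus.
Variables (R : realType) (V : normedModType R).
Implicit Types (f : V -> R) (x v w z : V).

Lemma is_derive_line (W : normedModType R) (f : V -> W) x v (s : R) (d : W) :
  is_derive (x + s *: v) v f d -> is_derive s 1 (fun t => f (x + t *: v)) d.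
Proof.
move=> [dfx dE].
have E : (fun h : R => h^-1 *: (((fun t => f (x + t *: v)) \o shift s) (h *: 1) -
    f (x + s *: v))) =
    (fun h => h^-1 *: ((f \o shift (x + s *: v)) (h *: v) - f (x + s *: v))).
  apply/funext => h /=; congr (_ *: (f _ - _)).
  by rewrite scaler1 scalerDl addrCA.
by split; [rewrite /derivable E|rewrite -dE /derive E].
Qed.

Lemma is_derive_translate (W : normedModType R) (f : V -> W) x v w (d : W) :
  is_derive (x + w) v f d -> is_derive x v (fun y => f (y + w)) d.
Proof.
move=> [dfx dE].
have E : (fun h : R => h^-1 *: (((fun y => f (y + w)) \o shift x) (h *: v) -
    f (x + w))) =
    (fun h => h^-1 *: ((f \o shift (x + w)) (h *: v) - f (x + w))).
  by apply/funext => h /=; rewrite addrA.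
by split; [rewrite /derivable E|rewrite -dE /derive E].
Qed.

Lemma MVT_line f (f' : V -> R) z v (s : R) : 0 < s ->
  (forall t, 0 <= t <= s -> is_derive (z + t *: v) v f (f' (z + t *: v))) ->
  exists2 t, 0 < t < s & f (z + s *: v) - f z = s * f' (z + t *: v).
Proof.
move=> s0 df.
have dl (t : R) : 0 <= t <= s ->
    is_derive t 1 (fun t => f (z + t *: v)) (f' (z + t *: v)).
  by move=> ts; exact/is_derive_line/df.
have dlo t : t \in `]0, s[%R ->
    is_derive t 1 (fun t => f (z + t *: v)) (f' (z + t *: v)).
  by move=> tI; apply: dl; rewrite !ltW ?(itvP tI).
have dlc : {within `[0, s], continuous (fun t => f (z + t *: v))}.
  apply: derivable_within_continuous => t tI.
  by apply: ex_derive; apply: dl; rewrite !(itvP tI).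
have [t tI] := MVT s0 dlo dlc.
rewrite scale0r addr0 subr0 mulrC => ->.
by exists t => //; rewrite (itvP tI).
Qed.

(** Keeps mean value arguments in two directions inside a neighbourhood; with one direction equal to
    0 it provides a segment. *)
Lemma near_parallelogram (P : set V) x v w : nbhs x P ->
  exists2 s : R, 0 < s & forall a b, 0 <= a <= s -> 0 <= b <= s ->
    P (x + a *: v + b *: w).
Proof.
move=> /nbhs_ballP[e /= e0 eP].
(* The added 1 keeps [m] positive when both directions vanish. *)
pose m := `|v| + `|w| + 1.
have m0 : 0 < m by rewrite ltr_wpDl// addr_ge0.
exists (e / m / 2); first by rewrite !divr_gt0.
move=> a b /andP[a0 ae] /andP[b0 be]; apply: eP.
rewrite -ball_normE/= !opprD !addrA subrr add0r -opprD normrN.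
rewrite (le_lt_trans (ler_normD _ _))// !normrZ !ger0_norm//.
apply: (@le_lt_trans _ _ (e / m / 2 * `|v| + e / m / 2 * `|w|)).
  by rewrite lerD// ler_wpM2r.
rewrite -mulrDr; apply: (@lt_le_trans _ _ (e / m * m)); last first.
  by rewrite divfK// gt_eqF.
have em : 0 < e / m by rewrite divr_gt0.
apply: (@le_lt_trans _ _ (e / m / 2 * m)).
  by apply: ler_wpM2l; [rewrite divr_ge0// ltW|rewrite /m lerDl].
by rewrite ltr_pM2r// ltr_pdivrMr// ltr_pMr// ltr1n.
Qed.

(** The mean value theorem is applied in the direction [v] to the increment [f (y + s *: w) - f y],
    then in the direction [w] to [fv], with the first intermediate point frozen. *)
Lemma second_difference f (fv fvw : V -> R) x v w (s : R) : 0 < s ->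
  (forall a b, 0 <= a <= s -> 0 <= b <= s ->
    is_derive (x + a *: v + b *: w) v f (fv (x + a *: v + b *: w)) /\
    is_derive (x + a *: v + b *: w) w fv (fvw (x + a *: v + b *: w))) ->
  exists a b, [/\ 0 <= a <= s, 0 <= b <= s &
    f (x + s *: v + s *: w) - f (x + s *: v) - (f (x + s *: w) - f x) =
    s * (s * fvw (x + a *: v + b *: w))].
Proof.
move=> s0 sP.
have sI t : 0 < t < s -> 0 <= t <= s by move=> /andP[/ltW -> /ltW ->].
have s0s : 0 <= s <= s by rewrite lexx ltW.
have s00 : 0 <= (0 : R) <= s by rewrite lexx ltW.
have [t tI|a /sI aI Ea] := @MVT_line (fun y => f (y + s *: w) - f y)
    (fun y => fv (y + s *: w) - fv y) x v s s0.
  have [d1 _] := sP _ _ tI s0s.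
  have [d2 _] := sP _ _ tI s00.
  rewrite scale0r addr0 in d2.
  exact: is_deriveB (is_derive_translate d1) d2.
have [b tI|b /sI bI Eb] := @MVT_line fv fvw (x + a *: v) w s s0.
  by have [] := sP _ _ aI tI.
by exists a, b; split => //; rewrite Ea Eb.
Qed.

(** Both orders of differentiation express the same second difference, so the mixed derivatives
    agree at two points of an arbitrarily small parallelogram, and continuity at [x] concludes. The
    derivatives are supplied as functions so that the lemma applies to a pressure whose gradient is
    known only through the equation. *)
Lemma schwarz f (fv fw fvw fwv : V -> R) x v w :
  (\forall y \near x, is_derive y v f (fv y)) ->
  (\forall y \near x, is_derive y w f (fw y)) ->
  (\forall y \near x, is_derive y w fv (fvw y)) ->
  (\forall y \near x, is_derive y v fw (fwv y)) ->
  {for x, continuous fvw} -> {for x, continuous fwv} -> fvw x = fwv x.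
Proof.
move=> dv dw dvw dwv cvw cwv.
suff H e : 0 < e -> `|fvw x - fwv x| <= e + e.
  apply/eqP; rewrite -subr_eq0 -normr_le0; apply/ler_addgt0Pr => e e0.
  by rewrite add0r (splitr e) H// divr_gt0.
move=> e0.
have nc (k : V -> R) : {for x, continuous k} -> \forall y \near x, `|k x - k y| <= e.
  by move=> /cvgrPdist_le; exact.
move: cvw cwv => /nc cvw /nc cwv.
have : \forall y \near x, [/\ is_derive y v f (fv y) /\ is_derive y w fv (fvw y),
    is_derive y w f (fw y) /\ is_derive y v fw (fwv y),
    `|fvw x - fvw y| <= e & `|fwv x - fwv y| <= e].
  move: dv; apply: filter_app; move: dw; apply: filter_app.
  move: dvw; apply: filter_app; move: dwv; apply: filter_app.
  move: cvw; apply: filter_app; move: cwv; apply: filter_app.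
  by apply: nearW.
move=> /near_parallelogram-/(_ v w)[s s0 sP].
have [a' b' a'I b'I|a [b [aI bI E1]]] := @second_difference f fv fvw x v w s s0.
  by have [] := sP a' b' a'I b'I.
have [a' b' a'I b'I|c [d [cI dI E2]]] := @second_difference f fw fwv x w v s s0.
  by rewrite addrAC; have [] := sP b' a' b'I a'I.
have [_ _ B1 _] := sP _ _ aI bI.
have [_ _ _ B2] := sP _ _ dI cI.
(* The second difference is symmetric in [v] and [w]; each side is that number divided twice by
   [s]. *)
have E : fvw (x + a *: v + b *: w) = fwv (x + d *: v + c *: w).
  have s0' : s != 0 by rewrite gt_eqF.
  apply/(mulfI s0')/(mulfI s0'); rewrite -E1 [in RHS]addrAC -E2.
  by rewrite [x + s *: w + s *: v]addrAC opprB opprB addrACA; ring.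
rewrite -(subrK (fvw (x + a *: v + b *: w)) (fvw x)) -addrA.
rewrite (le_trans (ler_normD _ _))// lerD// E distrC//.
Qed.
End LineCalculus.

(** * Total differentiability from continuous partial derivatives *)

Section Differentiability.
Variables (R : realType).

Lemma differentiable_eps (V W : normedModType R) (f : V -> W)
    (df : {linear V -> W}) (x : V) : continuous df ->
  (forall e : R, 0 < e ->
    \forall h \near 0, `|f (h + x) - (f x + df h)| <= e * `|h|) ->
  differentiable f x.
Proof.
move=> dc dfP.
have E : f \o shift x = cst (f x) + df +o_ 0 id.
  by apply/eqaddoP => e e0; exact: dfP.
by apply/diff_locallyP; rewrite (diff_unique dc E).
Qed.

Lemma near_eq_differentiable (V W : normedModType R) (f g : V -> W) (x : V) :
  (\forall y \near x, f y = g y) -> differentiable f x -> differentiable g x.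
Proof.
move=> fg df; apply: (differentiable_eps (df := 'd f x)).
  exact: diff_continuous df.
move=> e e0.
have dl := diff_locally df; move/eqaddoP: dl => /(_ e e0).
apply: filter_app.
have fg0 : \forall h \near 0, f (h + x) = g (h + x).
  by have := fg; rewrite (near_shift 0) subr0.
move: fg0; apply: filterS => h fgh.
by rewrite -(nbhs_singleton fg) -fgh.
Qed.

Lemma derive_chain (U V W : normedModType R) (f : U -> V) (F : V -> W) x v :
  differentiable f x -> differentiable F (f x) ->
  'D_v (F \o f) x = 'D_('D_v f x) F (f x).
Proof.
move=> df dF; have dFf := differentiable_comp df dF.
by rewrite (deriveE _ dFf) (deriveE _ dF) (deriveE _ df) (diff_comp df dF).
Qed.

Lemma derive_dirD (V W : normedModType R) (F : V -> W) z v w :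
  differentiable F z -> 'D_(v + w) F z = 'D_v F z + 'D_w F z.
Proof. by move=> dF; rewrite !(deriveE _ dF) linearD. Qed.

Lemma derive_dirZ (V W : normedModType R) (F : V -> W) z (a : R) v :
  differentiable F z -> 'D_(a *: v) F z = a *: 'D_v F z.
Proof. by move=> dF; rewrite !(deriveE _ dF) linearZ. Qed.

Lemma derive_dir1 (W : normedModType R) (F : R -> W) (z a : R) :
  differentiable F z -> 'D_a F z = a *: 'D_1 F z.
Proof. by move=> dF; rewrite -derive_dirZ// [_ *: _]mulr1. Qed.

Lemma derive_dir2 (W : normedModType R) (F : R * R -> W) z (a : R * R) :
  differentiable F z ->
  'D_a F z = a.1 *: 'D_(1, 0) F z + a.2 *: 'D_(0, 1) F z.
Proof.
move=> dF; rewrite -!derive_dirZ// -derive_dirD//; congr ('D__ F z).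
by case: a => a b; rewrite [RHS]surjective_pairing/= /GRing.scale/= !mulr0 !mulr1 addr0 add0r.
Qed.

Lemma derive_pair (V W1 W2 : normedModType R) (f : V -> W1) (g : V -> W2) x v :
  differentiable f x -> differentiable g x ->
  'D_v (fun y => (f y, g y)) x = ('D_v f x, 'D_v g x).
Proof.
move=> df dg; have dfg := differentiable_pair df dg.
by rewrite (deriveE _ dfg) (deriveE _ df) (deriveE _ dg) (diff_pair df dg).
Qed.

(** Candidate differential of a function of two variables whose partial derivatives are [a] and
    [b]. *)
Definition lin2 (a b : R) (h : R * R) : R := h.1 * a + h.2 * b.

Lemma lin2_linear a b : linear (lin2 a b).
Proof. by move=> k x y; rewrite /lin2/= /GRing.scale/=; ring. Qed.

HB.instance Definition _ a b :=
  GRing.isLinear.Build R (R * R)%type R _ (lin2 a b) (lin2_linear a b).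

(** Increments around a point have either sign; a negative one is treated by starting from the other
    end point. *)
Lemma MVT_line_signed (V : normedModType R) (f f' : V -> R) z v (s : R) :
  (forall t, `|t| <= `|s| -> is_derive (z + t *: v) v f (f' (z + t *: v))) ->
  exists2 t, `|t| <= `|s| & f (z + s *: v) - f z = s * f' (z + t *: v).
Proof.
move=> df; have [s0|s0|s0] := ltgtP 0 s.
- have [t tI|t /andP[t0 ts] E] := @MVT_line R V f f' z v s s0.
    by apply: df; case/andP: tI => t0 ts; rewrite !ger0_norm// ltW.
  by exists t => //; rewrite !gtr0_norm// ltW.
- have ns0 : 0 < - s by rewrite oppr_gt0.
  have zs (t : R) : z + s *: v + t *: v = z + (s + t) *: v.
    by rewrite scalerDl addrA.
  have [t tI|t /andP[t0 ts] E] := @MVT_line R V f f' (z + s *: v) v (- s) ns0.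
    rewrite zs; apply: df; case/andP: tI => t0 ts.
    by rewrite (ltr0_norm s0) ler_norml; apply/andP; split; lra.
  exists (s + t); first by rewrite (ltr0_norm s0) ler_norml; apply/andP; split; lra.
  move: E; rewrite !zs subrr scale0r addr0 => E; rewrite -opprB E; ring.
- by exists 0; rewrite -?s0 ?normr0// scale0r addr0 subrr mul0r.
Qed.

(** The increment is split into a horizontal and a vertical move. On each, the mean value theorem
    produces a partial derivative at a nearby point, which continuity compares with its value at [z]
    up to [e / 2]. *)
Lemma differentiable_partials (F F1 F2 : R * R -> R) (z : R * R) :
  (\forall y \near z, is_derive (y : R * R) (1, 0) F (F1 y)) ->
  (\forall y \near z, is_derive (y : R * R) (0, 1) F (F2 y)) ->
  {for z, continuous F1} -> {for z, continuous F2} -> differentiable F z.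
Proof.
move=> d1 d2 c1 c2.
have lc : continuous (lin2 (F1 z) (F2 z)).
  move=> h; apply: cvgD.
    by apply: cvgMl; exact: cvg_fst.
  by apply: cvgMl; exact: cvg_snd.
apply: differentiable_eps lc _ => e e0.
have e20 : 0 < e / 2 by rewrite divr_gt0.
have nP : \forall y \near z, [/\ is_derive (y : R * R) (1, 0) F (F1 y),
    is_derive (y : R * R) (0, 1) F (F2 y), `|F1 z - F1 y| <= e / 2 &
    `|F2 z - F2 y| <= e / 2].
  have c1' : \forall y \near z, `|F1 z - F1 y| <= e / 2.
    by move/cvgrPdist_le : c1; exact.
  have c2' : \forall y \near z, `|F2 z - F2 y| <= e / 2.
    by move/cvgrPdist_le : c2; exact.
  by near=> y; split; near: y.
move: nP => /nbhs_ballP[r /= r0 rP].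
(* The norm of a product is the maximum of the norms, so shrinking the coordinates of [h] separately
   stays in the ball. *)
have zP (h : R * R) a b : `|h| < r -> `|a| <= `|h.1| -> `|b| <= `|h.2| ->
    ball z r (z + a *: (1, 0) + b *: (0, 1)).
  move=> hr ah bh; rewrite -ball_normE/= !opprD !addrA subrr add0r -opprD normrN.
  have -> : a *: (1, 0) + b *: (0, 1) = (a, b) :> R * R.
    by rewrite [LHS]surjective_pairing/= /GRing.scale/= !mulr0 !mulr1 addr0 add0r.
  apply: le_lt_trans hr; rewrite !prod_normE/= ge_max !le_max ah bh orbT.
  by [].
apply/nbhs_ballP; exists r => //= h; rewrite -ball_normE/= sub0r normrN => hr.
have hzE : h + z = z + h.1 *: (1, 0) + h.2 *: (0, 1).
  rewrite -addrA addrC; congr (_ + _); case: h {hr} => a b.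
  by rewrite [RHS]surjective_pairing/= /GRing.scale/= !mulr0 !mulr1 addr0 add0r.
have [t th E2] : exists2 t, `|t| <= `|h.2| &
    F (z + h.1 *: (1, 0) + h.2 *: (0, 1)) - F (z + h.1 *: (1, 0)) =
    h.2 * F2 (z + h.1 *: (1, 0) + t *: (0, 1)).
  by apply: MVT_line_signed => t th; have [] := rP _ (zP h h.1 t hr (lexx _) th).
have [t' t'h E1] : exists2 t, `|t| <= `|h.1| &
    F (z + h.1 *: (1, 0)) - F z = h.1 * F1 (z + t *: (1, 0)).
  apply: MVT_line_signed => t' t'h.
  have h20 : `|0 : R| <= `|h.2| by rewrite normr0.
  by have [] := rP _ (zP h t' 0 hr t'h h20); rewrite scale0r addr0.
have [_ _ _ B2] := rP _ (zP h h.1 t hr (lexx _) th).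
have h20 : `|0 : R| <= `|h.2| by rewrite normr0.
have [_ _ B1 _] := rP _ (zP h t' 0 hr t'h h20).
rewrite scale0r addr0 in B1.
rewrite hzE /lin2.
have -> : F (z + h.1 *: (1, 0) + h.2 *: (0, 1)) - (F z + (h.1 * F1 z + h.2 * F2 z)) =
    - (h.1 * (F1 z - F1 (z + t' *: (1, 0))) +
       h.2 * (F2 z - F2 (z + h.1 *: (1, 0) + t *: (0, 1)))).
  by rewrite !mulrBr -E1 -E2; ring.
rewrite normrN (le_trans (ler_normD _ _))// !normrM.
have : `|h.1| <= `|h| by rewrite prod_normE le_max lexx.
have : `|h.2| <= `|h| by rewrite prod_normE le_max lexx orbT.
move=> h2 h1; rewrite (splitr e) mulrDl; apply: lerD.
  by rewrite mulrC ler_pM.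
by rewrite mulrC ler_pM.
Unshelve. all: by end_near. Qed.
End Differentiability.

(** * Smooth functions *)

Section SmoothFunctions.
Variables (R : realType).

(** Level [k] asks that the iterated directional derivatives of order at most [k] be totally
    differentiable on [D]; level 0 is differentiability. Total differentiability makes the chain
    rule available at every order. *)
Fixpoint smooth_on (V : normedModType R) (k : nat) (D : set V) (f : V -> R) : Prop :=
  (forall x, D x -> differentiable f x) /\
  (if k is k'.+1 then forall v, smooth_on k' D ('D_v f) else True).

Implicit Types (V : normedModType R) (k : nat).

Lemma smooth_on_diff V k (D : set V) f x :
  smooth_on k D f -> D x -> differentiable f x.
Proof. by case: k => [|k] [df _] /df. Qed.

Lemma smooth_on_derivable V k (D : set V) f x v :
  smooth_on k D f -> D x -> is_derive x v f ('D_v f x).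
Proof. by move=> sf Dx; exact/derivableP/diff_derivable/(smooth_on_diff sf). Qed.

Lemma smooth_onS V k (D : set V) f : smooth_on k.+1 D f -> smooth_on k D f.
Proof.
elim: k f => [|k IH] f [df sf]; split => // v; exact: IH (sf v).
Qed.

Lemma near_open V (D : set V) (P : V -> Prop) x :
  open D -> D x -> (forall y, D y -> P y) -> \forall y \near x, P y.
Proof. by move=> oD Dx DP; apply: (filterS DP); exact: open_nbhs_nbhs. Qed.

Lemma smooth_on_eq V k (D : set V) f g : open D ->
  (forall x, D x -> f x = g x) -> smooth_on k D f -> smooth_on k D g.
Proof.
move=> oD; elim: k f g => [|k IH] f g fg [df sf]; split => //.
- move=> x Dx; apply: near_eq_differentiable (df x Dx); exact: (near_open oD Dx fg).
- move=> x Dx; apply: near_eq_differentiable (df x Dx); exact: (near_open oD Dx fg).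
- move=> v; apply: IH (sf v) => x Dx.
  by apply: near_eq_derive; exact: (near_open oD Dx fg).
Qed.

(** Serves to patch spherical charts with neighbourhoods of the polar axis. *)
Lemma smooth_on_local V k (D : set V) f :
  (forall x, D x -> exists E, E x /\ smooth_on k E f) -> smooth_on k D f.
Proof.
elim: k f => [|k IH] f H; split => //.
- by move=> x /H[E [Ex sf]]; exact: smooth_on_diff sf Ex.
- by move=> x /H[E [Ex sf]]; exact: smooth_on_diff sf Ex.
- by move=> v; apply: IH => x /H[E [Ex [_ sf]]]; exists E; split=> //; exact: sf.
Qed.

Lemma smooth_on_affine V k (D : set V) f (c : V -> R) :
  (forall x, differentiable f x) -> (forall v x, 'D_v f x = c v) -> smooth_on k D f.
Proof.
elim: k f c => [|k IH] f c df dc; split => // v.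
have -> : 'D_v f = cst (c v) by apply/funext => x; rewrite dc.
apply: (IH _ (fun=> 0)) => [x|w x]; last exact: derive_cst.
exact: differentiable_cst.
Qed.

Lemma smooth_on_cst V k (D : set V) (c : R) : smooth_on k D (cst c).
Proof.
apply: (@smooth_on_affine _ _ _ _ (fun=> 0)) => [x|w x]; last exact: derive_cst.
exact: differentiable_cst.
Qed.

Lemma smooth_on_id k (D : set R) : smooth_on k D id.
Proof.
by apply: (@smooth_on_affine _ _ _ _ id) => [x|v x] //; rewrite derive_id.
Qed.

Lemma smooth_onD V k (D : set V) f g : open D ->
  smooth_on k D f -> smooth_on k D g -> smooth_on k D (fun x => f x + g x).
Proof.
move=> oD; elim: k f g => [|k IH] f g [df sf] [dg sg]; split => //.
- by move=> x Dx; apply: differentiableD; [exact: df|exact: dg].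
- by move=> x Dx; apply: differentiableD; [exact: df|exact: dg].
- move=> v; apply: smooth_on_eq (IH _ _ (sf v) (sg v)) => // x Dx.
  by rewrite deriveD//; apply: diff_derivable; [exact: df|exact: dg].
Qed.

Lemma smooth_onM V k (D : set V) f g : open D ->
  smooth_on k D f -> smooth_on k D g -> smooth_on k D (fun x => f x * g x).
Proof.
move=> oD; elim: k f g => [|k IH] f g sf sg; split => //.
- by move=> x Dx; apply: differentiableM; [exact: sf.1|exact: sg.1].
- by move=> x Dx; apply: differentiableM; [exact: sf.1|exact: sg.1].
- move=> v; have [df sf'] := sf; have [dg sg'] := sg.
  have := smooth_onD oD (IH _ _ (smooth_onS sf) (sg' v)) (IH _ _ (smooth_onS sg) (sf' v)).
  apply: smooth_on_eq => // x Dx.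
  by rewrite deriveM//; apply: diff_derivable; [exact: df|exact: dg].
Qed.

Lemma smooth_onN V k (D : set V) f : open D ->
  smooth_on k D f -> smooth_on k D (fun x => - f x).
Proof.
move=> oD sf; apply: smooth_on_eq (smooth_onM oD (@smooth_on_cst _ k D (-1)) sf) => //.
by move=> x Dx; rewrite /= mulN1r.
Qed.

Lemma smooth_onB V k (D : set V) f g : open D ->
  smooth_on k D f -> smooth_on k D g -> smooth_on k D (fun x => f x - g x).
Proof. by move=> oD sf sg; apply: smooth_onD => //; exact: smooth_onN. Qed.

(** The derivative is ['D_v f] times the composition of ['D_1 F] with [f]; the induction treats this
    composition one level lower. *)
Lemma smooth_on_comp V k (D : set V) (E : set R) (F : R -> R) f : open D ->
  (forall x, D x -> E (f x)) -> smooth_on k E F -> smooth_on k D f ->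
  smooth_on k D (fun x => F (f x)).
Proof.
move=> oD DE; elim: k F => [|k IH] F sF sf.
  by split => // x Dx; apply: differentiable_comp; [exact: sf.1|exact/sF.1/DE].
split => [x Dx|v].
  by apply: differentiable_comp; [exact: sf.1|exact/sF.1/DE].
have := smooth_onM oD (sf.2 v) (IH _ (sF.2 1) (smooth_onS sf)).
apply: smooth_on_eq => // x Dx; rewrite -[RHS]/('D_v (F \o f) x).
have dF := sF.1 _ (DE _ Dx).
by rewrite (derive_chain _ (sf.1 _ Dx) dF) [RHS](derive_dir1 _ dF).
Qed.

Lemma smooth_on_comp2 V k (D : set V) (E : set (R * R)) (F : R * R -> R) f g :
  open D -> (forall x, D x -> E (f x, g x)) ->
  smooth_on k E F -> smooth_on k D f -> smooth_on k D g ->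
  smooth_on k D (fun x => F (f x, g x)).
Proof.
move=> oD DE; elim: k F => [|k IH] F sF sf sg.
  split => // x Dx; apply: (@differentiable_comp _ _ _ _ (fun x => (f x, g x))).
    by apply: differentiable_pair; [exact: sf.1|exact: sg.1].
  exact/sF.1/DE.
have dfg x : D x -> differentiable (fun x => (f x, g x)) x.
  by move=> Dx; apply: differentiable_pair; [exact: sf.1|exact: sg.1].
split => [x Dx|v].
  by apply: (@differentiable_comp _ _ _ _ (fun x => (f x, g x)));
    [exact: dfg|exact/sF.1/DE].
have := smooth_onD oD
  (smooth_onM oD (sf.2 v) (IH _ (sF.2 (1, 0)) (smooth_onS sf) (smooth_onS sg)))
  (smooth_onM oD (sg.2 v) (IH _ (sF.2 (0, 1)) (smooth_onS sf) (smooth_onS sg))).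
apply: smooth_on_eq => // x Dx; rewrite -[RHS]/('D_v (F \o (fun x => (f x, g x))) x).
have dF := sF.1 _ (DE _ Dx).
rewrite (derive_chain _ (dfg _ Dx) dF) [RHS](derive_dir2 _ dF).
by rewrite (derive_pair _ (sf.1 _ Dx) (sg.1 _ Dx)).
Qed.

(** On the line it suffices to know an explicit derivative. When that derivative is expressed
    through the function itself, as for the inverse and the square root, the induction hypothesis on
    the function lifts it by one level. *)
Lemma smooth_on_derive1 k (D : set R) (F F' : R -> R) : open D ->
  (forall x, D x -> is_derive x 1 F (F' x)) ->
  (if k is k'.+1 then smooth_on k' D F' else True) -> smooth_on k D F.
Proof.
move=> oD dF sF.
have ddF x : D x -> differentiable F x.
  by move=> /dF[? _]; apply/derivable1_diffP.
case: k sF => [|k] sF; split => // v.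
apply: smooth_on_eq (smooth_onM oD (@smooth_on_cst _ k D v) sF) => // x Dx.
by rewrite (derive_dir1 _ (ddF _ Dx)); have [_ ->] := dF _ Dx.
Qed.

Lemma smooth_on_inv k : smooth_on k [set x : R | x != 0] GRing.inv.
Proof.
have oD : open [set x : R | x != 0] by exact: open_neq.
have dV (x : R) : x != 0 -> is_derive x 1 GRing.inv (- (x^-1 * x^-1)).
  move=> x0; have := @is_deriveV R id x 1 1 x0 (is_derive_id _ _).
  by rewrite /= [_ *: 1]mulr1 -expr2 exprVn.
elim: k => [|k IH]; apply: (smooth_on_derive1 oD dV) => //.
exact/smooth_onN/smooth_onM.
Qed.

Lemma smooth_onV V k (D : set V) f : open D -> (forall x, D x -> f x != 0) ->
  smooth_on k D f -> smooth_on k D (fun x => (f x)^-1).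
Proof. by move=> oD f0; exact: smooth_on_comp f0 (smooth_on_inv k). Qed.

Lemma smooth_on_sqrt k : smooth_on k [set x : R | 0 < x] Num.sqrt.
Proof.
have oD : open [set x : R | 0 < x] by exact: open_gt.
have dS (x : R) : 0 < x -> is_derive x 1 Num.sqrt ((2 * Num.sqrt x)^-1).
  by move=> x0; exact: is_derive1_sqrt.
elim: k => [|k IH]; apply: (smooth_on_derive1 oD dS) => //.
apply: smooth_onV => // [x x0|].
  by rewrite mulf_neq0// gt_eqF// sqrtr_gt0.
by apply: smooth_onM => //; exact: smooth_on_cst.
Qed.

(** Each function is the derivative of the other up to sign, so both rise together. *)
Lemma smooth_on_sin_cos k :
  smooth_on k [set: R] (@sin R) /\ smooth_on k [set: R] (@cos R).
Proof.
have oT := @openT R.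
elim: k => [|k [IHs IHc]]; split.
- by apply: (smooth_on_derive1 oT (F' := cos)).
- by apply: (smooth_on_derive1 oT (F' := fun x => - sin x)).
- by apply: (smooth_on_derive1 oT (F' := cos)).
- apply: (smooth_on_derive1 oT (F' := fun x => - sin x)) => //.
  exact: smooth_onN.
Qed.

Lemma smooth_on_atan k : smooth_on k [set: R] (@atan R).
Proof.
have oT := @openT R.
apply: (smooth_on_derive1 oT (F' := fun x => (1 + x ^+ 2)^-1)) => //.
case: k => // k.
apply: smooth_onV => // [x _|].
  by rewrite gt_eqF// ltr_pwDl// sqr_ge0.
apply: smooth_onD => //; first exact: smooth_on_cst.
by under eq_fun do rewrite expr2; apply: smooth_onM => //; exact: smooth_on_id.
Qed.

End SmoothFunctions.

(** * Regularity up to the boundary of an open set *)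

Section ClosureSmooth.
Variables (R : realType).
Implicit Types (V W : normedModType R) (k : nat).

Lemma Ck_closureS V W k (D : set V) (f : V -> W) :
  Ck_closure D k.+1 f -> Ck_closure D k f.
Proof.
elim: k f => [|k IH] f [cf df]; split => // v.
by have [g /IH sg dg] := df v; exists g.
Qed.

Lemma within_closure_continuous V W (D : set V) (f : V -> W) x : open D ->
  {within closure D, continuous f} -> D x -> {for x, continuous f}.
Proof.
move=> oD /(continuous_subspaceW (@subset_closure _ D)).
by rewrite continuous_open_subspace// => cf Dx; apply: cf; rewrite inE.
Qed.

(** The shift in order appears because level [k] of [smooth_on] already asserts [k + 1]
    derivatives. *)
Lemma smooth_on_closure1 k (D : set R) (f : R -> R) : open D ->
  Ck_closure D k.+1 f -> smooth_on k D f.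
Proof.
move=> oD; elim: k f => [|k IH] f [_ df].
  have [f' _ df'] := df 1.
  exact: (smooth_on_derive1 (k := 0) oD df').
have [f' sf' df'] := df 1.
exact: (smooth_on_derive1 (k := k.+1) oD df' (IH _ sf')).
Qed.

(** [Ck_closure] speaks of directional derivatives only; their continuity upgrades them to total
    differentiability. *)
Lemma smooth_on_closure2 k (D : set (R * R)) (f : R * R -> R) : open D ->
  Ck_closure D k.+1 f -> smooth_on k D f.
Proof.
move=> oD; elim: k f => [|k IH] f sf.
  split => // x Dx.
  have [f1 [cf1 _] df1] := sf.2 (1, 0).
  have [f2 [cf2 _] df2] := sf.2 (0, 1).
  apply: (@differentiable_partials _ _ f1 f2).
  - exact: (near_open oD Dx df1).
  - exact: (near_open oD Dx df2).
  - exact: (within_closure_continuous oD cf1 Dx).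
  - exact: (within_closure_continuous oD cf2 Dx).
split; first by move=> x Dx; exact: smooth_on_diff (IH _ (Ck_closureS sf)) Dx.
move=> v; have [g /IH sg dg] := sf.2 v.
by apply: smooth_on_eq sg => // x Dx; have [_ ->] := dg _ Dx.
Qed.

Lemma row_differentiable V n (F : V -> 'rV[R]_n) x :
  (forall i, differentiable (fun y => F y 0 i) x) -> differentiable F x.
Proof.
move=> dF.
have -> : F = \sum_(i < n) (fun y => F y 0 i *: (delta_mx 0 i : 'rV_n)).
  by apply/funext => y; rewrite {1}[F y]row_sum_delta fct_sumE.
apply: differentiable_sum => i; exact: differentiableZl.
Qed.

Lemma is_derive_row V n (F : V -> 'rV[R]_n) (G : 'rV[R]_n) x v :
  (forall i, is_derive x v (fun y => F y 0 i) (G 0 i)) -> is_derive x v F G.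
Proof.
move=> dF; have dFx : derivable F x v.
  by apply/derivable_mxP => i j; rewrite ord1; have [] := dF j.
split => //; rewrite derive_mx//; apply/rowP => i.
by rewrite mxE; have [_] := dF i.
Qed.

Lemma is_derive_coord V n (F : V -> 'rV[R]_n) (G : 'rV[R]_n) x v i :
  is_derive x v F G -> is_derive x v (fun y => F y 0 i) (G 0 i).
Proof.
move=> [dF <-]; split; first by have /derivable_mxP/(_ 0 i) := dF.
by rewrite derive_mx// mxE.
Qed.

(** The derivatives of the global field [F] serve as the continuous extensions that [Ck_closure]
    asks for. *)
Lemma smooth_on_Ck_closure V n k (D : set V) (f F : V -> 'rV[R]_n) : open D ->
  (forall i, smooth_on k setT (fun x => F x 0 i)) ->
  (forall x, closure D x -> f x = F x) -> Ck_closure D k f.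
Proof.
move=> oD; elim: k f F => [|k IH] f F sF fF.
  split => //.
  apply: (@subspace_eq_continuous _ _ _ F).
    by move=> x; rewrite inE => /fF.
  apply: continuous_subspaceT => x; apply: differentiable_continuous.
  by apply: row_differentiable => i; exact: (sF i).1.
split.
  apply: (@subspace_eq_continuous _ _ _ F).
    by move=> x; rewrite inE => /fF.
  apply: continuous_subspaceT => x; apply: differentiable_continuous.
  by apply: row_differentiable => i; exact: (sF i).1.
move=> v; pose G x : 'rV[R]_n := \row_i 'D_v (fun x => F x 0 i) x.
exists G.
  apply: (IH _ G) => // i.
  have -> : (fun x => G x 0 i) = 'D_v (fun x => F x 0 i).
    by apply/funext => x; rewrite mxE.
  exact: (sF i).2.
move=> x Dx; apply: (@near_eq_is_derive _ _ _ F).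
  by apply: (near_open oD Dx) => y Dy; rewrite fF//; exact: subset_closure.
apply: is_derive_row => i; rewrite mxE.
by apply: smooth_on_derivable; [exact: sF|].
Qed.

Lemma Ck_closure_coord V n k (D : set V) (f : V -> 'rV[R]_n) i :
  Ck_closure D k f -> Ck_closure D k (fun x => f x 0 i).
Proof.
have cc (g : V -> 'rV[R]_n) : {within closure D, continuous g} ->
    {within closure D, continuous (fun x => g x 0 i)}.
  move=> cg x; exact: (@continuous_comp (subspace (closure D)) _ _ g (fun M : 'rV_n => M 0 i)
    x (cg x) (@coord_continuous _ _ _ 0 i (g x))).
elim: k f => [|k IH] f [/cc cf df]; split => // v.
have [g sg dg] := df v; exists (fun x => g x 0 i); first exact: IH.
by move=> x Dx; apply: is_derive_coord; exact: dg.
Qed.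

End ClosureSmooth.

Lemma smooth_mixed (R : realType) (V : normedModType R) (D : set V) (f : V -> R)
    v w x : open D -> smooth_on 2 D f -> D x ->
  'D_w ('D_v f) x = 'D_v ('D_w f) x.
Proof.
move=> oD sf Dx.
have s1 z : smooth_on 1 D ('D_z f) := sf.2 z.
have s2 y z : smooth_on 0 D ('D_y ('D_z f)) := (s1 z).2 y.
apply: (@schwarz R V f ('D_v f) ('D_w f) ('D_w ('D_v f)) ('D_v ('D_w f)) x v w).
- by apply: (near_open oD Dx) => y Dy; exact: (smooth_on_derivable v sf Dy).
- by apply: (near_open oD Dx) => y Dy; exact: (smooth_on_derivable w sf Dy).
- by apply: (near_open oD Dx) => y Dy; exact: (smooth_on_derivable w (s1 v) Dy).
- by apply: (near_open oD Dx) => y Dy; exact: (smooth_on_derivable v (s1 w) Dy).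
- by apply: differentiable_continuous; exact: (smooth_on_diff (s2 w v) Dx).
- by apply: differentiable_continuous; exact: (smooth_on_diff (s2 v w) Dx).
Qed.

Lemma closure_ray (R : realType) (V : normedModType R) (D : set V) (z w : V) (s0 : R) :
  0 < s0 -> (forall s, 0 < s < s0 -> D (z + s *: w)) -> closure D z.
Proof.
move=> s00 Ds B /near_parallelogram-/(_ w 0)[s s_gt0 Bs].
pose t := Num.min s (s0 / 2).
have t0 : 0 < t by rewrite lt_min s_gt0 divr_gt0.
exists (z + t *: w); split.
  apply: Ds; rewrite t0 gt_min; apply/orP; right.
  by rewrite ltr_pdivrMr// ltr_pMr// ltr1n.
have := Bs t 0; rewrite scale0r addr0; apply.
  by rewrite ltW//= ge_min lexx.
by rewrite lexx ltW.
Qed.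

(** * Euclidean geometry of the unit ball *)

Section Space.
Variables (R : realType).
Implicit Types (x y v w : 'rV[R]_3).

Lemma sum3 (M : nmodType) (F : 'I_3 -> M) :
  \sum_(i < 3) F i = F 0 + F 1 + F 2%:R.
Proof.
rewrite !big_ord_recr big_ord0 /= add0r.
by congr (F _ + F _ + F _); exact: val_inj.
Qed.

Lemma ord3_ind (P : 'I_3 -> Prop) : P 0 -> P 1 -> P 2%:R -> forall i, P i.
Proof.
move=> P0 P1 P2 [[|[|[|//]]] i3].
- by rewrite (_ : Ordinal i3 = 0) //; exact: val_inj.
- by rewrite (_ : Ordinal i3 = 1) //; exact: val_inj.
- by rewrite (_ : Ordinal i3 = 2%:R) //; exact: val_inj.
Qed.

Lemma ord3_add : [/\ 1 + 2%:R = 0 :> 'I_3, 2%:R + 1 = 0 :> 'I_3,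
  2%:R + 2%:R = 1 :> 'I_3 & 1 + 1 = 2%:R :> 'I_3].
Proof. by split; exact: val_inj. Qed.

Lemma row3P x y : x 0 0 = y 0 0 -> x 0 1 = y 0 1 -> x 0 2%:R = y 0 2%:R -> x = y.
Proof. by move=> e0 e1 e2; apply/rowP; apply: ord3_ind. Qed.

Lemma vec3E (a b c : R) :
  (vec3 a b c 0 0 = a) * (vec3 a b c 0 1 = b) * (vec3 a b c 0 2%:R = c).
Proof. by split; [split|]; rewrite mxE. Qed.

Lemma dotE v w : dot v w = v 0 0 * w 0 0 + v 0 1 * w 0 1 + v 0 2%:R * w 0 2%:R.
Proof. by rewrite /dot sum3. Qed.

Lemma dotC v w : dot v w = dot w v.
Proof. by apply: eq_bigr => i _; rewrite mulrC. Qed.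

Lemma enorm_ge0 x : 0 <= enorm x.
Proof. exact: sqrtr_ge0. Qed.

Lemma dotxx_ge0 x : 0 <= dot x x.
Proof. by rewrite dotE -!expr2 !addr_ge0 ?sqr_ge0. Qed.

Lemma enorm_sqr x : enorm x ^+ 2 = dot x x.
Proof. by rewrite sqr_sqrtr// dotxx_ge0. Qed.

Lemma dotxx_eq0 x : dot x x = 0 -> x = 0.
Proof.
rewrite dotE -!expr2 => /eqP; rewrite !paddr_eq0 ?addr_ge0 ?sqr_ge0// !sqrf_eq0.
by case/andP => /andP[/eqP x0 /eqP x1] /eqP x2; apply: row3P; rewrite mxE.
Qed.

Lemma enormZ (a : R) x : enorm (a *: x) = `|a| * enorm x.
Proof.
rewrite /enorm -sqrtr_sqr -sqrtrM ?sqr_ge0//; congr Num.sqrt.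
by rewrite !dotE !mxE; ring.
Qed.

Lemma enorm0 : enorm (0 : 'rV[R]_3) = 0.
Proof. by rewrite -(scale0r 0) enormZ normr0 mul0r. Qed.

Lemma enorm_eq0 x : enorm x = 0 -> x = 0.
Proof. by move=> x0; apply: dotxx_eq0; rewrite -enorm_sqr x0 expr0n. Qed.

Lemma coord_smooth k (D : set 'rV[R]_3) i : smooth_on k D (fun x => x 0 i).
Proof.
apply: (@smooth_on_affine _ _ _ _ _ (fun v => v 0 i)) => [x|v x].
  exact: differentiable_coord.
by have [_] := is_derive_coord i (is_derive_id x v).
Qed.

Lemma dot_smooth k (D : set 'rV[R]_3) : open D -> smooth_on k D (fun x => dot x x).
Proof.
move=> oD; under eq_fun do rewrite dotE.
by do !apply: smooth_onD => //; apply: smooth_onM => //; exact: coord_smooth.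
Qed.

Lemma enorm_continuous : continuous (@enorm R).
Proof.
move=> x; apply: (@continuous_comp _ _ _ (fun y => dot y y) Num.sqrt).
  apply: differentiable_continuous.
  exact: (dot_smooth 0 openT).1.
exact: sqrt_continuous.
Qed.

Lemma Omega_open : open (@Omega R).
Proof.
by apply: (@open_comp _ _ (@enorm R) [set r | r < 1]) => [x _|];
  [exact: enorm_continuous|exact: open_lt].
Qed.

(** A point of norm at most 1 is the limit of its contractions [(1 - s) *: x]. *)
Lemma closure_Omega : closure (@Omega R) = [set x | enorm x <= 1].
Proof.
apply/seteqP; split => [|x /= x1].
  have /closure_id -> : closed [set x : 'rV[R]_3 | enorm x <= 1].
    by apply: (@closed_comp _ _ (@enorm R) [set r | r <= 1]) => [x _|];
      [exact: enorm_continuous|exact: closed_le].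
  by apply: closureS => x /ltW.
apply: (@closure_ray _ _ _ x (- x) 1) => // s /andP[s0 s1].
rewrite scalerN -{1}[x]scale1r -scalerBl /Omega/= enormZ gtr0_norm ?subr_gt0//.
by rewrite (le_lt_trans (ler_wpM2l _ x1))// ?subr_ge0 ?ltW// mulr1 ltrBlDr ltrDl.
Qed.

(** On the half plane [X > 0] the polar angle is [atan (Y / X)]. A chart uses this twice: for the
    azimuth in the horizontal plane, and for the latitude in a meridian half plane. *)
Lemma polar_plane (X Y : R) : 0 < X ->
  Num.sqrt (X ^+ 2 + Y ^+ 2) * cos (atan (Y / X)) = X /\
  Num.sqrt (X ^+ 2 + Y ^+ 2) * sin (atan (Y / X)) = Y.
Proof.
move=> X0.
have s : Num.sqrt (X ^+ 2 + Y ^+ 2) = X * Num.sqrt (1 + (Y / X) ^+ 2).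
  rewrite -{2}(gtr0_norm X0) -sqrtr_sqr -sqrtrM ?sqr_ge0//; congr Num.sqrt.
  by field; rewrite gt_eqF.
have c : Num.sqrt (X ^+ 2 + Y ^+ 2) * cos (atan (Y / X)) = X.
  rewrite s cos_atan mulfK// gt_eqF// sqrtr_gt0.
  by rewrite ltr_pwDl// sqr_ge0.
have c0 : cos (atan (Y / X)) != 0.
  by rewrite cos_atan invr_eq0 gt_eqF// sqrtr_gt0 ltr_pwDl// sqr_ge0.
split => //; have : tan (atan (Y / X)) = Y / X by rewrite atanK.
rewrite /tan => t.
have -> : sin (atan (Y / X)) = Y / X * cos (atan (Y / X)).
  by apply: (mulIf (invr_neq0 c0)); rewrite t mulfK.
by rewrite mulrCA mulrC c mulrC divfK// gt_eqF.
Qed.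

Lemma enorm_spherical (r theta phi : R) : 0 <= r -> enorm (spherical r theta phi) = r.
Proof.
move=> r0; rewrite -[RHS](ger0_norm r0) -sqrtr_sqr; congr Num.sqrt.
rewrite dotE !vec3E.
have := cos2Dsin2 phi; have := cos2Dsin2 theta.
set a := cos theta; set b := sin theta; set c := cos phi; set d := sin phi.
move=> h1 h2.
by transitivity (r ^+ 2 * (b ^+ 2 * (c ^+ 2 + d ^+ 2) + a ^+ 2)); [ring|
  rewrite h2 mulr1 addrC h1 mulr1].
Qed.

Lemma sphericalZ (s r theta phi : R) :
  s *: spherical r theta phi = spherical (s * r) theta phi.
Proof. by apply: row3P; rewrite mxE !vec3E; ring. Qed.

End Space.

(** * Spherical charts and the extended field *)

(* Spherical coordinates with azimuth in [(phi0 - pi/2, phi0 + pi/2)], written with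
   [atan] only so that their smoothness is immediate. *)
Section SphericalChart.
Variables (R : realType) (phi0 : R).
Implicit Types (x : 'rV[R]_3).

(** With [chart_eta], these are the horizontal coordinates after a rotation by [- phi0]: azimuth
    [phi0] becomes the half line [chart_eta x = 0], [chart_xi x > 0]. *)
Definition chart_xi x : R := x 0 0 * cos phi0 + x 0 1 * sin phi0.
Definition chart_eta x : R := x 0 1 * cos phi0 - x 0 0 * sin phi0.
Definition chart_rho x : R := Num.sqrt (chart_xi x ^+ 2 + chart_eta x ^+ 2).
(** The polar angle is the complement of the latitude. *)
Definition chart_theta x : R := pi / 2 - atan (x 0 2%:R / chart_rho x).
Definition chart_phi x : R := phi0 + atan (chart_eta x / chart_xi x).
Definition chart_dom : set 'rV[R]_3 := [set x | 0 < chart_xi x].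

Lemma chart_dotE x : dot x x = chart_xi x ^+ 2 + chart_eta x ^+ 2 + x 0 2%:R ^+ 2.
Proof.
rewrite dotE /chart_xi /chart_eta; have := cos2Dsin2 phi0.
set c := cos phi0; set s := sin phi0 => cs.
rewrite -[x 0 0 * x 0 0]mulr1 -[x 0 1 * x 0 1]mulr1 -cs; ring.
Qed.

Lemma chart_sum_gt0 x : chart_dom x -> 0 < chart_xi x ^+ 2 + chart_eta x ^+ 2.
Proof. by move=> x0; rewrite ltr_pwDl ?sqr_ge0// exprn_gt0. Qed.

Lemma chart_rho_gt0 x : chart_dom x -> 0 < chart_rho x.
Proof. by move=> /chart_sum_gt0; rewrite sqrtr_gt0. Qed.

Lemma chart_enorm_gt0 x : chart_dom x -> 0 < enorm x.
Proof.
by move=> /chart_sum_gt0 x0; rewrite sqrtr_gt0 chart_dotE ltr_pwDl// sqr_ge0.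
Qed.

Lemma chart_theta_itv x : 0 < chart_theta x < pi.
Proof.
have := atan_gtNpi2 (x 0 2%:R / chart_rho x).
have := atan_ltpi2 (x 0 2%:R / chart_rho x).
by rewrite /chart_theta => a b; apply/andP; split; lra.
Qed.

Lemma chartK x : chart_dom x ->
  x = spherical (enorm x) (chart_theta x) (chart_phi x).
Proof.
move=> Dx; have [X Y] := polar_plane (chart_eta x) Dx.
have [X' Z] := polar_plane (x 0 2%:R) (chart_rho_gt0 Dx).
have rho2 : chart_rho x ^+ 2 = chart_xi x ^+ 2 + chart_eta x ^+ 2.
  by rewrite sqr_sqrtr// ltW// chart_sum_gt0.
rewrite rho2 -chart_dotE -/(enorm x) in X' Z.
rewrite -/(chart_rho x) in X Y.
have st : enorm x * sin (chart_theta x) = chart_rho x.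
  by rewrite -[RHS]X' /chart_theta sinB cos_pihalf sin_pihalf mul1r mul0r subr0.
have ct : enorm x * cos (chart_theta x) = x 0 2%:R.
  by rewrite -[RHS]Z /chart_theta cosB cos_pihalf sin_pihalf mul0r add0r mul1r.
have cs := cos2Dsin2 phi0.
apply: row3P; rewrite !vec3E ?st ?ct// /chart_phi ?cosD ?sinD.
- transitivity (cos phi0 * chart_xi x - sin phi0 * chart_eta x); last first.
    by apply: esym; rewrite mulrBr ![chart_rho x * (_ * _)]mulrCA X Y.
  rewrite -[LHS]mulr1 -cs /chart_xi /chart_eta; ring.
- transitivity (sin phi0 * chart_xi x + cos phi0 * chart_eta x); last first.
    by apply: esym; rewrite mulrDr ![chart_rho x * (_ * _)]mulrCA X Y.
  rewrite -[LHS]mulr1 -cs /chart_xi /chart_eta; ring.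
Qed.

Lemma chart_xi_smooth k D : open D -> smooth_on k D chart_xi.
Proof.
move=> oD; apply: smooth_onD => //; apply: smooth_onM => //;
  by [exact: coord_smooth|exact: smooth_on_cst].
Qed.

Lemma chart_eta_smooth k D : open D -> smooth_on k D chart_eta.
Proof.
move=> oD; apply: smooth_onB => //; apply: smooth_onM => //;
  by [exact: coord_smooth|exact: smooth_on_cst].
Qed.

Lemma chart_dom_open : open chart_dom.
Proof.
apply: (@open_comp _ _ chart_xi [set r | 0 < r]) => [x _|]; last exact: open_gt.
by apply: differentiable_continuous; exact: (chart_xi_smooth 0 openT).1.
Qed.

Lemma chart_rho_smooth k : smooth_on k chart_dom chart_rho.
Proof.
have oD := chart_dom_open.
apply: (smooth_on_comp oD chart_sum_gt0 (smooth_on_sqrt R k)).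
under eq_fun do rewrite !expr2.
apply: smooth_onD => //; apply: smooth_onM => //;
  by [exact: chart_xi_smooth|exact: chart_eta_smooth].
Qed.

Lemma chart_enorm_smooth k : smooth_on k chart_dom (@enorm R).
Proof.
have oD := chart_dom_open.
apply: (smooth_on_comp oD _ (smooth_on_sqrt R k)); last exact: dot_smooth.
by move=> x /chart_enorm_gt0; rewrite /= sqrtr_gt0.
Qed.

Lemma chart_theta_smooth k : smooth_on k chart_dom chart_theta.
Proof.
have oD := chart_dom_open.
apply: smooth_onB => //; first exact: smooth_on_cst.
apply: (smooth_on_comp oD _ (smooth_on_atan R k)) => //.
apply: smooth_onM => //; first exact: coord_smooth.
apply: smooth_onV => //; last exact: chart_rho_smooth.
by move=> x /chart_rho_gt0; exact: lt0r_neq0.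
Qed.

Lemma chart_phi_smooth k : smooth_on k chart_dom chart_phi.
Proof.
have oD := chart_dom_open.
apply: smooth_onD => //; first exact: smooth_on_cst.
apply: (smooth_on_comp oD _ (smooth_on_atan R k)) => //.
apply: smooth_onM => //; first exact: chart_eta_smooth.
apply: smooth_onV => //; last exact: chart_xi_smooth.
by move=> x; exact: lt0r_neq0.
Qed.

End SphericalChart.

(** The azimuths 0, pi and plus or minus pi / 2 give four open half spaces that miss exactly the
    axis. *)
Lemma chart_cover (R : realType) (x : 'rV[R]_3) :
  (exists phi0 : R, chart_dom phi0 x) \/ x = vec3 0 0 (x 0 2%:R).
Proof.
have [x0|x0|x0] := ltgtP (x 0 0) 0.
- left; exists pi; rewrite /chart_dom/= /chart_xi cospi sinpi; lra.
- left; exists 0; rewrite /chart_dom/= /chart_xi cos0 sin0; lra.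
have [x1|x1|x1] := ltgtP (x 0 1) 0.
- left; exists (- (pi / 2)).
  by rewrite /chart_dom/= /chart_xi cosN sinN cos_pihalf sin_pihalf; lra.
- by left; exists (pi / 2); rewrite /chart_dom/= /chart_xi cos_pihalf sin_pihalf; lra.
by right; apply: row3P; rewrite !vec3E.
Qed.

Section SlipExtension.
Variables (R : realType) (h : R -> R) (g : R * R -> R) (u0 : 'rV[R]_3 -> 'rV[R]_3).
Hypotheses (Hh : radial_profile h) (Hg : angular_profile g)
  (Hu : slip_field h g u0).

(* The datum scales like [h r] along rays; extrapolating from the unit sphere
   makes its boundary values ordinary values of a globally smooth field.  At the
   origin the junk inverse [0^-1 = 0] is harmless because [h 0 = 0]. *)
Definition slip_extension (x : 'rV[R]_3) : 'rV[R]_3 :=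
  (h (enorm x) / h 1) *: u0 ((enorm x)^-1 *: x).

Local Notation U := slip_extension.

Definition slip_formula (r theta phi : R) : 'rV[R]_3 :=
  - (h r / sin theta * d_phi g theta phi) *: e_theta theta phi
  + (h r * d_theta g theta phi) *: e_phi phi.

Lemma radial0 : h 0 = 0.
Proof. by case: Hh => _ [d d0 hd] _ _; apply: hd; rewrite lexx. Qed.

Lemma slip_formulaZ r theta phi :
  slip_formula r theta phi = (h r / h 1) *: slip_formula 1 theta phi.
Proof.
case: Hh => _ _ _ h1.
have hr : h r = h r / h 1 * h 1 by rewrite divfK.
rewrite /slip_formula {1 2}hr; set s := (sin theta)^-1; set k := h r / h 1.
by apply: row3P; rewrite !mxE /=; ring.
Qed.

Lemma extension_spherical r theta phi : 0 <= r -> 0 < theta < pi ->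
  U (spherical r theta phi) = slip_formula r theta phi.
Proof.
move=> r0 th; rewrite /U enorm_spherical// slip_formulaZ.
have [->|rn0] := eqVneq r 0; first by rewrite radial0 mul0r !scale0r.
by rewrite sphericalZ mulVf// (Hu.1 1)// ler01 lexx.
Qed.

Lemma extension_axis z : U (vec3 0 0 z) = 0.
Proof.
rewrite /U; set r := enorm _.
have rE : r = `|z|.
  rewrite /r /enorm dotE !vec3E -sqrtr_sqr; congr Num.sqrt; ring.
have -> : r^-1 *: vec3 0 0 z = vec3 0 0 (r^-1 * z).
  by apply: row3P; rewrite mxE !vec3E ?mulr0.
rewrite Hu.2 ?scaler0// -ler_norml rE normrM normfV normr_id.
by have [->|z0] := eqVneq `|z| 0; rewrite ?mulr0 ?ler01// mulVf.
Qed.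

Lemma extension_eq x : enorm x <= 1 -> U x = u0 x.
Proof.
move=> x1; have [[phi0 Dx]|xE] := chart_cover x; last first.
  rewrite xE extension_axis Hu.2// -ler_norml.
  apply: le_trans x1; rewrite -sqrtr_sqr; apply: ler_wsqrtr.
  by rewrite dotE lerDr -!expr2 addr_ge0 ?sqr_ge0.
rewrite (chartK Dx) extension_spherical ?enorm_ge0 ?chart_theta_itv//.
by rewrite Hu.1 ?chart_theta_itv// enorm_ge0.
Qed.

End SlipExtension.

Lemma open_prod (S T : topologicalType) (A : set S) (B : set T) :
  open A -> open B -> open (A `*` B).
Proof.
move=> oA oB; apply: openI.
  by apply: (@open_comp _ _ fst) => // x _; exact: cvg_fst.
by apply: (@open_comp _ _ snd) => // x _; exact: cvg_snd.
Qed.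

Definition angular_strip (R : realType) : set (R * R) := `]0, pi[%classic `*` [set: R].

Lemma angular_strip_open (R : realType) : open (@angular_strip R).
Proof. by apply: open_prod; [exact: itv_open|exact: openT]. Qed.

Lemma angular_stripP (R : realType) (theta phi : R) :
  0 < theta < pi -> angular_strip (theta, phi).
Proof. by move=> th; split => //=; rewrite in_itv/=. Qed.

Lemma smooth_row_zero (R : realType) (V : normedModType R) n k (D : set V)
    (F : V -> 'rV[R]_n) i : open D ->
  (forall x, D x -> F x = 0) -> smooth_on k D (fun x => F x 0 i).
Proof.
move=> oD F0; apply: smooth_on_eq (@smooth_on_cst _ _ k D 0) => // x /F0 ->.
by rewrite mxE.
Qed.

(** * Smoothness of the extended field across the polar axis *)

Section SlipExtensionSmooth.
Variables (R : realType) (h : R -> R) (g : R * R -> R) (u0 : 'rV[R]_3 -> 'rV[R]_3).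
Hypotheses (Hh : radial_profile h) (Hg : angular_profile g)
  (Hu : slip_field h g u0).

Local Notation U := (slip_extension h u0).
Local Notation strip := (@angular_strip R).

Lemma radial_smooth k : @smooth_on R R k `]0, +oo[%classic h.
Proof.
by case: Hh => hs _ _ _; apply: smooth_on_closure1 (hs k.+1); exact: itv_open_ends_open.
Qed.

Lemma angular_smooth k : smooth_on k strip g.
Proof.
by case: Hg => gs _ _ _; apply: smooth_on_closure2 (gs k.+1);
  exact: angular_strip_open.
Qed.

Lemma d_theta_smooth k : smooth_on k strip (fun z => d_theta g z.1 z.2).
Proof.
have -> : (fun z => d_theta g z.1 z.2) = 'D_(1, 0) g by apply/funext => -[].
exact: (angular_smooth k.+1).2.
Qed.

Lemma d_phi_smooth k : smooth_on k strip (fun z => d_phi g z.1 z.2).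
Proof.
have -> : (fun z => d_phi g z.1 z.2) = 'D_(0, 1) g by apply/funext => -[].
exact: (angular_smooth k.+1).2.
Qed.

(** In a chart the norm is positive and the polar angle lies strictly between 0 and pi, so neither
    [h (enorm x)] nor the division by the sine is singular. *)
Lemma extension_chart_smooth phi0 k i :
  smooth_on k (chart_dom phi0) (fun x => U x 0 i).
Proof.
set D := chart_dom phi0; have oD : open D := @chart_dom_open R phi0.
pose th := chart_theta phi0; pose ph := chart_phi phi0.
have sth : smooth_on k D th := @chart_theta_smooth R phi0 k.
have sph : smooth_on k D ph := @chart_phi_smooth R phi0 k.
have sh : smooth_on k D (fun x => h (enorm x)).
  apply: (smooth_on_comp oD _ (radial_smooth k)).
    by move=> x /chart_enorm_gt0; rewrite /= in_itv/= andbT.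
  exact: chart_enorm_smooth.
have strD x : D x -> strip (th x, ph x).
  by move=> Dx; apply: angular_stripP; exact: chart_theta_itv.
have sgt := smooth_on_comp2 oD strD (d_theta_smooth k) sth sph.
have sgp := smooth_on_comp2 oD strD (d_phi_smooth k) sth sph.
have [sT cT] := smooth_on_sin_cos R k.
have sst := smooth_on_comp oD (fun _ _ => I) sT sth.
have sct := smooth_on_comp oD (fun _ _ => I) cT sth.
have ssp := smooth_on_comp oD (fun _ _ => I) sT sph.
have scp := smooth_on_comp oD (fun _ _ => I) cT sph.
have siv : smooth_on k D (fun x => (sin (th x))^-1).
  apply: smooth_onV => // x Dx; rewrite gt_eqF//; apply: sin_gt0_pi.
  exact: chart_theta_itv.
have set_ : smooth_on k D (fun x => e_theta (th x) (ph x) 0 i).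
  elim/ord3_ind: i; under eq_fun do rewrite vec3E.
  - exact: smooth_onM.
  - exact: smooth_onM.
  - exact: smooth_onN.
have sep : smooth_on k D (fun x => e_phi (ph x) 0 i).
  elim/ord3_ind: i {set_}; under eq_fun do rewrite vec3E.
  - exact: smooth_onN.
  - exact: scp.
  - exact: smooth_on_cst.
pose F x := - (h (enorm x) * (sin (th x))^-1 * d_phi g (th x) (ph x))
    * e_theta (th x) (ph x) 0 i +
  h (enorm x) * d_theta g (th x) (ph x) * e_phi (ph x) 0 i.
have sF : smooth_on k D F.
  apply: smooth_onD => //; apply: smooth_onM => //.
    by apply: smooth_onN => //; apply: smooth_onM => //; exact: smooth_onM.
  exact: smooth_onM.
apply: smooth_on_eq sF => // x Dx.
rewrite [in RHS](chartK Dx) (extension_spherical Hh Hu) ?enorm_ge0 ?chart_theta_itv//.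
by rewrite /slip_formula mxE [in RHS]mxE [X in _ = _ + X]mxE.
Qed.

Lemma extension_near_origin : exists2 d : R, 0 < d &
  forall x : 'rV[R]_3, enorm x < d -> U x = 0.
Proof.
case: Hh => _ [d d0 hd] _ _; exists d => // x xd.
by rewrite /slip_extension hd ?mul0r ?scale0r// enorm_ge0.
Qed.

Lemma angular_zero_near (theta phi : R) (d : R) : 0 < theta < pi ->
  (forall theta phi : R, 0 <= theta <= pi -> theta < d \/ pi - d < theta ->
    g (theta, phi) = 0) ->
  theta < d \/ pi - d < theta ->
  d_theta g theta phi = 0 /\ d_phi g theta phi = 0.
Proof.
move=> th g0 thd.
have nz : \forall z \near (theta, phi), cst (0 : R) z = g z.
  (* [E] is the open half line, on whichever side contains [theta], where [g] is known to vanish. *)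
  pose E : set R := if asbool (theta < d) then [set t | t < d] else [set t | pi - d < t].
  have oE : open E by rewrite /E; case: ifP => _; [exact: open_lt|exact: open_gt].
  have Et : E theta.
    rewrite /E; case: asboolP => //= ntd; by case: thd.
  have o2 : open ((E `&` `]0, pi[%classic) `*` [set: R]).
    by apply: open_prod; [apply: openI => //; exact: itv_open|exact: openT].
  apply: (near_open o2) => [|[t p] [/= [Et' tI] _]].
    by split => //=; split => //=; rewrite in_itv.
  rewrite in_itv/= in tI; rewrite g0 ?(ltW (andP tI).1) ?(ltW (andP tI).2)//.
  by move: Et'; rewrite /E; case: asboolP => _ ?; [left|right].
split; rewrite /d_theta /d_phi -(near_eq_derive _ nz); exact: derive_cst.
Qed.

(** The condition describes an open double cone about the axis. With [c = cos d'] it says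
    [|cos theta| > cos d'], hence that [theta] is within [d'] of 0 or pi; the cap [pi / 2] on [d']
    keeps all angles in the range where the cosine decreases. *)
Lemma extension_near_axis : exists2 c : R, c < 1 &
  forall x : 'rV[R]_3, c * enorm x < `|x 0 2%:R| -> U x = 0.
Proof.
case: Hg => _ _ [d d0 gd] _.
pose d' := Num.min d (pi / 2).
have pi0 := pi_gt0 R.
have d'0 : 0 < d' by rewrite lt_min d0 divr_gt0.
have d'p : d' <= pi / 2 by rewrite ge_min lexx orbT.
exists (cos d').
  rewrite -cos0 ltr_cos//= in_itv/= ?lexx ?ltW//; lra.
move=> x cx; have [[phi0 Dx]|->] := chart_cover x; last first.
  by rewrite (extension_axis Hu).
move: cx; rewrite (chartK Dx).
set t := chart_theta phi0 x; set p := chart_phi phi0 x; set r := enorm x.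
have r0 : 0 < r := chart_enorm_gt0 Dx.
have tI : 0 < t < pi := chart_theta_itv _ _.
rewrite enorm_spherical ?ltW// vec3E normrM gtr0_norm// mulrC ltr_pM2l// => cx.
rewrite (extension_spherical Hh Hu) ?ltW//.
have td : t < d \/ pi - d < t.
  have [/andP[t0 tp]] := (tI).
  have d'd : d' <= d by rewrite ge_min lexx.
  have [c0|c0] := leP 0 (cos t).
    left; apply: lt_le_trans d'd.
    by rewrite -ltr_cos ?in_itv/= ?ltW//; [rewrite -(ger0_norm c0)|lra].
  right; suff : pi - t < d' by move=> ?; lra.
  rewrite -ltr_cos ?in_itv/=; [|lra|lra].
  by rewrite cosB cospi sinpi mulN1r mul0r addr0 -(ltr0_norm c0).
have [gt gp] := angular_zero_near p tI gd td.
by rewrite /slip_formula gt gp !mulr0 oppr0 !scale0r addr0.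
Qed.

(** The origin is not in the open double cone and needs the ball on which [h] vanishes; every other
    point of the axis lies in the cone because [c < 1]. *)
Lemma extension_axis_nbhs (x : 'rV[R]_3) : x = vec3 0 0 (x 0 2%:R) ->
  exists E : set 'rV[R]_3, [/\ open E, E x & forall y, E y -> U y = 0].
Proof.
move=> xE.
have [d d0 U0] := extension_near_origin.
have [c c1 U1] := extension_near_axis.
have [z0|z0] := eqVneq (x 0 2%:R) 0.
  exists [set x | enorm x < d]; split => //.
    apply: (@open_comp _ _ (@enorm R) [set r | r < d]) => [y _|]; last exact: open_lt.
    exact: enorm_continuous.
  by rewrite /= xE z0 (_ : vec3 _ _ _ = 0) ?enorm0//; apply: row3P; rewrite !vec3E mxE.
exists [set y : 'rV[R]_3 | 0 < `|y 0 2%:R| - c * enorm y]; split.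
- apply: (@open_comp _ _ (fun x : 'rV[R]_3 => `|x 0 2%:R| - c * enorm x) [set r | 0 < r]);
    last exact: open_gt.
  have cN : continuous (fun y : 'rV[R]_3 => `|y 0 2%:R|).
    by move=> y; apply: (@cvg_norm _ R _ (nbhs y)); exact: coord_continuous.
  have cE : continuous (fun y : 'rV[R]_3 => c * enorm y).
    by move=> y; apply: (@cvgMr R _ (nbhs y)); exact: enorm_continuous.
  by move=> y _; exact: (cvgB (cN y) (cE y)).
- rewrite /= subr_gt0 {1}xE.
  have -> : enorm (vec3 0 0 (x 0 2%:R)) = `|x 0 2%:R|.
    by rewrite /enorm dotE !vec3E -sqrtr_sqr; congr Num.sqrt; ring.
  by rewrite gtr_pMl ?normr_gt0.
- by move=> y; rewrite /= subr_gt0; exact: U1.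
Qed.

Lemma extension_smooth k i : smooth_on k setT (fun x => U x 0 i).
Proof.
apply: smooth_on_local => x _.
have [[phi0 Dx]|/extension_axis_nbhs[E [oE Ex U0]]] := chart_cover x.
  exists (chart_dom phi0); split => //; exact: extension_chart_smooth.
by exists E; split => //; exact: smooth_row_zero.
Qed.

End SlipExtensionSmooth.

(** * The spherical frame *)

Section ScalarRules.
Variables (R : realType) (V : normedModType R).
Implicit Types (f g : V -> R).

Lemma is_derive_mul f g x v df dg : is_derive x v f df -> is_derive x v g dg ->
  is_derive x v (fun y => f y * g y) (df * g x + f x * dg).
Proof. by move=> ? ?; apply: is_derive_eq; rewrite addrC /GRing.scale/= [g x * _]mulrC. Qed.

Lemma is_derive_add f g x v df dg : is_derive x v f df -> is_derive x v g dg ->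
  is_derive x v (fun y => f y + g y) (df + dg).
Proof. exact: is_deriveD. Qed.

Lemma is_derive_opp f x v df : is_derive x v f df ->
  is_derive x v (fun y => - f y) (- df).
Proof. exact: is_deriveN. Qed.

Lemma is_derive_const (c : R) x v : is_derive x v (fun _ : V => c) (0 : R).
Proof. exact: is_derive_cst. Qed.

End ScalarRules.

Lemma is_derive_fst (R : realType) (F : R * R -> R) (a b : R) :
  differentiable F (a, b) -> is_derive a 1 (fun t => F (t, b)) ('D_(1, 0) F (a, b)).
Proof.
move=> dF; have E t : (t, b) = (0, b) + t *: (1, 0) :> R * R.
  by rewrite [RHS]surjective_pairing/= /GRing.scale/= mulr1 mulr0 add0r addr0.
under eq_fun do rewrite E.
apply: is_derive_line; rewrite -E; exact/derivableP/diff_derivable.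
Qed.

Lemma is_derive_snd (R : realType) (F : R * R -> R) (a b : R) :
  differentiable F (a, b) -> is_derive b 1 (fun t => F (a, t)) ('D_(0, 1) F (a, b)).
Proof.
move=> dF; have E t : (a, t) = (a, 0) + t *: (0, 1) :> R * R.
  by rewrite [RHS]surjective_pairing/= /GRing.scale/= mulr1 mulr0 add0r addr0.
under eq_fun do rewrite E.
apply: is_derive_line; rewrite -E; exact/derivableP/diff_derivable.
Qed.

Section Frame.
Variable (R : realType).
Implicit Types (r theta phi : R).

Definition e_r theta phi : 'rV[R]_3 := spherical 1 theta phi.

Lemma is_derive_sin1 (t : R) : is_derive t 1 (@sin R) (cos t).
Proof. exact: is_derive_sin. Qed.
Lemma is_derive_cos1 (t : R) : is_derive t 1 (@cos R) (- sin t).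
Proof. exact: is_derive_cos. Qed.

Lemma spherical_e_r r theta phi : spherical r theta phi = r *: e_r theta phi.
Proof. by rewrite sphericalZ mulr1. Qed.

(** Leaves the derivative to be determined by the rules of [trig], without type class resolution;
    only an algebraic comparison with the announced value remains. *)
Local Ltac derive_by_rules := notypeclasses refine (@is_derive_eq _ _ _ _ _ _ _ _ _ _).

Local Ltac trig := repeat first [exact: is_derive_sin1 | exact: is_derive_cos1
  | exact: is_derive_const | apply: is_derive_mul | apply: is_derive_opp].

Lemma is_derive_e_r_theta theta phi i :
  is_derive theta 1 (fun t => e_r t phi 0 i) (e_theta theta phi 0 i).
Proof.
elim/ord3_ind: i; under eq_fun do rewrite vec3E; rewrite vec3E.
- by derive_by_rules; [trig|rewrite /= /GRing.scale/=; ring].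
- by derive_by_rules; [trig|rewrite /= /GRing.scale/=; ring].
- by derive_by_rules; [trig|rewrite /= /GRing.scale/=; ring].
Qed.

Lemma is_derive_e_r_phi theta phi i :
  is_derive phi 1 (fun t => e_r theta t 0 i) (sin theta * e_phi phi 0 i).
Proof.
elim/ord3_ind: i; under eq_fun do rewrite vec3E; rewrite vec3E.
- by derive_by_rules; [trig|rewrite /= /GRing.scale/=; ring].
- by derive_by_rules; [trig|rewrite /= /GRing.scale/=; ring].
- by derive_by_rules; [trig|rewrite /= /GRing.scale/=; ring].
Qed.

Lemma is_derive_e_theta_theta theta phi i :
  is_derive theta 1 (fun t => e_theta t phi 0 i) (- e_r theta phi 0 i).
Proof.
elim/ord3_ind: i; under eq_fun do rewrite vec3E; rewrite vec3E.
- by derive_by_rules; [trig|rewrite /= /GRing.scale/=; ring].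
- by derive_by_rules; [trig|rewrite /= /GRing.scale/=; ring].
- by derive_by_rules; [trig|rewrite /= /GRing.scale/=; ring].
Qed.

Lemma is_derive_e_theta_phi theta phi i :
  is_derive phi 1 (fun t => e_theta theta t 0 i) (cos theta * e_phi phi 0 i).
Proof.
elim/ord3_ind: i; under eq_fun do rewrite vec3E; rewrite vec3E.
- by derive_by_rules; [trig|rewrite /= /GRing.scale/=; ring].
- by derive_by_rules; [trig|rewrite /= /GRing.scale/=; ring].
- by derive_by_rules; [trig|rewrite /= /GRing.scale/=; ring].
Qed.

(** The derivative is minus the horizontal unit vector [(cos phi, sin phi, 0)]; it is written in the
    frame at [theta], whatever [theta] is, so that orthonormality can be used afterwards. *)
Lemma is_derive_e_phi theta phi i : is_derive phi 1 (fun t => e_phi t 0 i)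
  (- (sin theta * e_r theta phi 0 i + cos theta * e_theta theta phi 0 i)).
Proof.
have := cos2Dsin2 theta => cs.
elim/ord3_ind: i; under eq_fun do rewrite vec3E; rewrite !vec3E.
- derive_by_rules; [trig|].
  by rewrite /= /GRing.scale/= mul1r -[LHS]mul1r -[X in X * _ = _]cs; ring.
- derive_by_rules; [trig|].
  by rewrite /= /GRing.scale/= mul1r -[LHS]mul1r -[X in X * _ = _]cs; ring.
- by derive_by_rules; [trig|rewrite /= /GRing.scale/=; ring].
Qed.

Lemma frame_dot theta phi :
  [/\ dot (e_r theta phi) (e_r theta phi) = 1,
      dot (e_theta theta phi) (e_theta theta phi) = 1 &
      dot (e_phi phi) (e_phi phi) = 1] /\
  [/\ dot (e_r theta phi) (e_theta theta phi) = 0,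
      dot (e_r theta phi) (e_phi phi) = 0 &
      dot (e_theta theta phi) (e_phi phi) = 0].
Proof.
have := cos2Dsin2 theta; have := cos2Dsin2 phi.
rewrite !dotE !vec3E.
set a := cos theta; set b := sin theta; set c := cos phi; set d := sin phi.
move=> h1 h2; split; split.
- transitivity (b ^+ 2 * (c ^+ 2 + d ^+ 2) + a ^+ 2); [ring|by rewrite h1 mulr1 addrC].
- transitivity (a ^+ 2 * (c ^+ 2 + d ^+ 2) + b ^+ 2); [ring|by rewrite h1 mulr1].
- rewrite -h1; ring.
- transitivity (a * b * (c ^+ 2 + d ^+ 2) - a * b); [ring|by rewrite h1 mulr1 subrr].
- ring.
- ring.
Qed.

(** Completeness of the frame: inserted into a trace, it turns Cartesian components into components
    in the frame. *)
Lemma frame_resolution theta phi i j :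
  e_r theta phi 0 i * e_r theta phi 0 j + e_theta theta phi 0 i * e_theta theta phi 0 j
  + e_phi phi 0 i * e_phi phi 0 j = (i == j)%:R.
Proof.
have := cos2Dsin2 theta; have := cos2Dsin2 phi.
set a := cos theta; set b := sin theta; set c := cos phi; set d := sin phi.
move=> h1 h2.
have h2' : b ^+ 2 = 1 - a ^+ 2 by rewrite -h2 addrC addKr.
have h1' : d ^+ 2 = 1 - c ^+ 2 by rewrite -h1 addrC addKr.
elim/ord3_ind: i; elim/ord3_ind: j; rewrite !vec3E -/a -/b -/c -/d /=.
- transitivity (c ^+ 2 * (a ^+ 2 + b ^+ 2) + d ^+ 2); [ring|by rewrite h2 mulr1].
- transitivity (c * d * (a ^+ 2 + b ^+ 2) - c * d); [ring|by rewrite h2 mulr1 subrr].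
- ring.
- transitivity (c * d * (a ^+ 2 + b ^+ 2) - c * d); [ring|by rewrite h2 mulr1 subrr].
- transitivity (d ^+ 2 * (a ^+ 2 + b ^+ 2) + c ^+ 2); [ring|by rewrite h2 mulr1 addrC].
- ring.
- ring.
- ring.
- rewrite -[RHS]h2; ring.
Qed.

Lemma derive_coordinates (f : 'rV[R]_3 -> R) x v : differentiable f x ->
  'D_v f x = \sum_(j < 3) v 0 j * partial j f x.
Proof.
move=> df; rewrite deriveE// {1}[v]row_sum_delta linear_sum.
by apply: eq_bigr => j _; rewrite linearZ /partial deriveE.
Qed.

End Frame.

Lemma is_derive_along (R : realType) n (f : 'rV[R]_n -> R) (c : R -> 'rV[R]_n)
    (v : 'rV[R]_n) (t : R) : differentiable f (c t) ->
  (forall j, is_derive t 1 (fun s => c s 0 j) (v 0 j)) ->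
  is_derive t 1 (fun s => f (c s)) ('D_v f (c t)).
Proof.
move=> df dc.
have dct : differentiable c t.
  by apply: row_differentiable => j; apply/derivable1_diffP; have [] := dc j.
have [_ <-] := is_derive_row dc.
have <- := @derive_chain R R _ _ c f t 1 dct df.
by apply/derivableP/diff_derivable; exact: (differentiable_comp dct df).
Qed.

(** * Action of the Jacobian on the position vector *)

Section SlipExtensionGeometry.
Variables (R : realType) (h : R -> R) (g : R * R -> R) (u0 : 'rV[R]_3 -> 'rV[R]_3).
Hypotheses (Hh : radial_profile h) (Hg : angular_profile g)
  (Hu : slip_field h g u0).

Local Notation U := (slip_extension h u0).
Local Notation dU i v x := ('D_v (fun y => U y 0 i) x).

Lemma extension_diff i x : differentiable (fun y => U y 0 i) x.
Proof. exact: (extension_smooth Hh Hg Hu 0 i).1. Qed.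

Lemma extension_curve (c : R -> 'rV[R]_3) (v : 'rV[R]_3) (t : R) i :
  (forall j, is_derive t 1 (fun s => c s 0 j) (v 0 j)) ->
  is_derive t 1 (fun s => U (c s) 0 i) (dU i v (c t)).
Proof.
by move=> dc; exact: (is_derive_along (extension_diff i (c t)) dc).
Qed.

Lemma extension_orthogonal x : dot (U x) x = 0.
Proof.
have [[phi0 Dx]|->] := chart_cover x; last first.
  by rewrite (extension_axis Hu) dotE !mxE !mul0r !addr0.
rewrite (chartK Dx) (extension_spherical Hh Hu) ?enorm_ge0 ?chart_theta_itv//.
set r := enorm x; set t := chart_theta phi0 x; set p := chart_phi phi0 x.
have [_ [rt rp _]] := frame_dot t p.
rewrite /slip_formula spherical_e_r; set P := - _; set Q := _ * _.
transitivity (r * P * dot (e_r t p) (e_theta t p) + r * Q * dot (e_r t p) (e_phi p)).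
  by rewrite !dotE !mxE /=; ring.
by rewrite rt rp !mulr0 addr0.
Qed.

Lemma extension_transpose (x : 'rV[R]_3) i :
  \sum_(j < 3) x 0 j * partial i (fun y => U y 0 j) x = - U x 0 i.
Proof.
have dj j : is_derive x (delta_mx 0 i) (fun y => U y 0 j * y 0 j)
    (dU j (delta_mx 0 i) x * x 0 j + U x 0 j * (i == j)%:R).
  apply: is_derive_mul.
    by apply/derivableP/diff_derivable; exact: extension_diff.
  have := is_derive_coord j (is_derive_id x (delta_mx 0 i)).
  by rewrite mxE eqxx/= eq_sym.
have := is_derive_add (is_derive_add (dj 0) (dj 1)) (dj 2%:R).
(* The differentiated function [dot (U y) y] vanishes on the whole space. *)
under eq_fun do rewrite -dotE extension_orthogonal.
move=> [_]; rewrite derive_cst => /esym/eqP.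
rewrite -[X in X == _]/(_ : R) => E.
rewrite sum3 /partial; apply/eqP; rewrite -subr_eq0 opprK -[X in _ == X](eqP E).
by apply/eqP; elim/ord3_ind: i {dj E}; rewrite /=; ring.
Qed.

(** Along the ray, [U (x + s *: x)] is [h (1 + s) / h 1] times [U x]. Its derivative at [s = 0] is
    computed once by the chain rule and once from [h' 1 = - h 1]. *)
Lemma extension_ray (x : 'rV[R]_3) i : enorm x = 1 ->
  \sum_(j < 3) x 0 j * partial j (fun y => U y 0 i) x = - U x 0 i.
Proof.
move=> x1; have [hs _ h1' h1] := Hh.
rewrite -derive_coordinates; last exact: extension_diff.
have d1 : is_derive (0 : R) 1 (fun s => U (x + s *: x) 0 i) (dU i x x).
  by apply: (@is_derive_line R _ _ (fun y => U y 0 i) x x 0); rewrite scale0r addr0;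
    apply/derivableP/diff_derivable;
    exact: extension_diff.
have dh : is_derive (1 : R) 1 h (- h 1).
  have hd : differentiable h (1 : R).
    by apply: (smooth_on_diff (radial_smooth Hh 0)); rewrite /= in_itv/= ltr01.
  rewrite -[- h 1](_ : 'D_1 h 1 = _); first exact/derivableP/diff_derivable.
  by rewrite -derive1E; apply/eqP; rewrite -addr_eq0 addrC h1'.
have d2 : is_derive (0 : R) 1 (fun s => h (1 + s) / h 1 * U x 0 i) (- U x 0 i).
  have dh0 : is_derive (0 : R) 1 (fun s => h (1 + s)) (- h 1).
    have -> : (fun s => h (1 + s)) = (fun s => h (1 + s *: 1)).
      by apply/funext => s; rewrite [_ *: _]mulr1.
    by apply: (@is_derive_line R _ _ h 1 1 0); rewrite scale0r addr0.
  have d2 := is_derive_mul (is_derive_mul dh0 (@is_derive_const R R (h 1)^-1 0 1))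
    (@is_derive_const R R (U x 0 i) 0 1).
  by apply: (is_derive_eq d2); rewrite /= !mulr0 !addr0 mulNr divff// mulN1r.
have [_ <-] := d1; have [_ <-] := d2.
apply: near_eq_derive.
(* For [s > -1] the number [1 + s] is positive, hence it is the norm of [x + s *: x]. *)
have oS : open [set s : R | -1 < s] by exact: open_gt.
apply: (near_open oS) => [|s]; rewrite /= ?ltrN10// => s1.
have s0 : 0 < 1 + s by lra.
rewrite -[in LHS](scale1r x) scalerA mulr1 -scalerDl.
rewrite /slip_extension enormZ x1 mulr1 gtr0_norm// scalerA mulVf ?gt_eqF//.
by rewrite scale1r invr1 scale1r divff// scale1r mxE.
Qed.

End SlipExtensionGeometry.

(** * Tangential derivatives of the extended field in the frame *)

Section SlipFrame.
Variables (R : realType) (h : R -> R) (g : R * R -> R) (u0 : 'rV[R]_3 -> 'rV[R]_3).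
Hypotheses (Hh : radial_profile h) (Hg : angular_profile g)
  (Hu : slip_field h g u0).
Variables (r theta phi : R).
Hypotheses (r0 : 0 <= r) (th : 0 < theta < pi).

Local Notation U := (slip_extension h u0).
Local Notation dU i v x := ('D_v (fun y => U y 0 i) x).
Local Notation gt := (d_theta g theta phi).
Local Notation gp := (d_phi g theta phi).
Local Notation gtt := (d_theta (fun z => d_theta g z.1 z.2) theta phi).
Local Notation gtp := (d_phi (fun z => d_theta g z.1 z.2) theta phi).
Local Notation gpt := (d_theta (fun z => d_phi g z.1 z.2) theta phi).
Local Notation gpp := (d_phi (fun z => d_phi g z.1 z.2) theta phi).

Lemma slip_formulaE s t p i : slip_formula h g s t p 0 i =
  - (h s * (sin t)^-1 * d_phi g t p) * e_theta t p 0 i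
  + h s * d_theta g t p * e_phi p 0 i.
Proof. by rewrite [LHS]mxE [X in X + _ = _]mxE [X in _ + X = _]mxE. Qed.

(** The vector [r *: e_theta] is the velocity of the meridian through the point, so the slip formula
    is differentiated in [theta], including its frame vectors. *)
Lemma extension_derive_theta i :
  dU i (r *: e_theta theta phi) (spherical r theta phi) =
  h r * (cos theta / sin theta ^+ 2 * gp - (sin theta)^-1 * gpt)
     * e_theta theta phi 0 i
  + h r / sin theta * gp * e_r theta phi 0 i + h r * gtt * e_phi phi 0 i.
Proof.
have zD : angular_strip (theta, phi) by exact: angular_stripP.
have s0 : sin theta != 0 by rewrite gt_eqF// sin_gt0_pi.
have d1 : is_derive theta 1 (fun t => U (spherical r t phi) 0 i)
    (dU i (r *: e_theta theta phi) (spherical r theta phi)).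
  apply: (extension_curve Hh Hg Hu) => j; rewrite mxE.
  under eq_fun do rewrite spherical_e_r mxE.
  have := is_derive_mul (@is_derive_const R R r theta 1) (is_derive_e_r_theta theta phi j).
  by rewrite mul0r add0r.
have dgt : is_derive theta 1 (fun t => d_theta g t phi) gtt :=
  is_derive_fst (smooth_on_diff (d_theta_smooth Hg 0) zD).
have dgp : is_derive theta 1 (fun t => d_phi g t phi) gpt :=
  is_derive_fst (smooth_on_diff (d_phi_smooth Hg 0) zD).
have dV : is_derive theta 1 (fun t => (sin t)^-1) (- (sin theta) ^- 2 * cos theta).
  by apply: is_deriveV.
have dP := is_derive_opp (is_derive_mul (is_derive_mul
  (@is_derive_const R R (h r) theta 1) dV) dgp).
have dQ := is_derive_mul (@is_derive_const R R (h r) theta 1) dgt.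
have d2 := is_derive_add (is_derive_mul dP (is_derive_e_theta_theta theta phi i))
  (is_derive_mul dQ (@is_derive_const R R (e_phi phi 0 i) theta 1)).
have [_ <-] := d1.
have oI : open (`]0, pi[%classic : set R) by exact: itv_open.
(* The slip formula holds for angles in [(0, pi)] only, hence an identity near [theta]; along a
   parallel it holds for every azimuth. *)
have E : \forall t \near theta, - (h r * (sin t)^-1 * d_phi g t phi) * e_theta t phi 0 i
   + h r * d_theta g t phi * e_phi phi 0 i = U (spherical r t phi) 0 i.
  apply: (near_open oI) => [|t]; rewrite /= in_itv//= => tI.
  by rewrite (extension_spherical Hh Hu)// slip_formulaE.
rewrite -(near_eq_derive _ E); have [_ ->] := d2.
rewrite /=; move: gtt gtp gpt gpp gt gp (e_theta theta phi 0 i) (e_r theta phi 0 i)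
  (e_phi phi 0 i) (sin theta) (cos theta) (h r) => *; ring.
Qed.

(** The same computation along a parallel, whose velocity is [r * sin theta] times [e_phi]. *)
Lemma extension_derive_phi i :
  dU i (r * sin theta *: e_phi phi) (spherical r theta phi) =
  - (h r / sin theta * gpp) * e_theta theta phi 0 i
  - h r / sin theta * gp * cos theta * e_phi phi 0 i
  + h r * gtp * e_phi phi 0 i
  - h r * gt * (sin theta * e_r theta phi 0 i + cos theta * e_theta theta phi 0 i).
Proof.
have zD : angular_strip (theta, phi) by exact: angular_stripP.
have d1 : is_derive phi 1 (fun t => U (spherical r theta t) 0 i)
    (dU i (r * sin theta *: e_phi phi) (spherical r theta phi)).
  apply: (extension_curve Hh Hg Hu) => j; rewrite mxE.
  under eq_fun do rewrite spherical_e_r mxE.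
  have := is_derive_mul (@is_derive_const R R r phi 1) (is_derive_e_r_phi theta phi j).
  by rewrite mul0r add0r mulrA.
have dgt : is_derive phi 1 (fun t => d_theta g theta t) gtp :=
  is_derive_snd (smooth_on_diff (d_theta_smooth Hg 0) zD).
have dgp : is_derive phi 1 (fun t => d_phi g theta t) gpp :=
  is_derive_snd (smooth_on_diff (d_phi_smooth Hg 0) zD).
have dP := is_derive_opp (is_derive_mul
  (@is_derive_const R R (h r * (sin theta)^-1) phi 1) dgp).
have dQ := is_derive_mul (@is_derive_const R R (h r) phi 1) dgt.
have d2 := is_derive_add (is_derive_mul dP (is_derive_e_theta_phi theta phi i))
  (is_derive_mul dQ (is_derive_e_phi theta phi i)).
have [_ <-] := d1.
have E : (fun t => - (h r * (sin theta)^-1 * d_phi g theta t) * e_theta theta t 0 i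
   + h r * d_theta g theta t * e_phi t 0 i) = fun t => U (spherical r theta t) 0 i.
  by apply/funext => t; rewrite (extension_spherical Hh Hu)// slip_formulaE.
rewrite -E; have [_ ->] := d2.
rewrite /=; move: gtt gtp gpt gpp gt gp (e_theta theta phi 0 i) (e_r theta phi 0 i)
  (e_phi phi 0 i) (sin theta) (cos theta) (h r) => *; ring.
Qed.

Lemma angular_mixed : gpt = gtp.
Proof.
have zD : angular_strip (theta, phi) by exact: angular_stripP.
have oS := @angular_strip_open R.
have eT : (fun z => d_theta g z.1 z.2) = 'D_(1, 0) g by apply/funext => -[].
have eP : (fun z => d_phi g z.1 z.2) = 'D_(0, 1) g by apply/funext => -[].
rewrite eT eP /d_theta /d_phi.
exact: (@smooth_mixed R _ _ g (0, 1) (1, 0) _ oS (angular_smooth Hg 2) zD).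
Qed.

End SlipFrame.

Lemma derive_fst (R : realType) (F : R * R -> R) (a b : R) :
  'D_(1, 0) F (a, b) = 'D_1 (fun t => F (t, b)) a.
Proof.
rewrite /derive (_ : (fun s : R => _) = (fun s : R =>
  s^-1 *: (((fun t => F (t, b)) \o shift a) (s *: 1) - F (a, b))))//.
apply/funext => s /=; congr (_ *: (F _ - _)).
by rewrite [LHS]surjective_pairing/= /GRing.scale/= mulr0 add0r.
Qed.

(* [spin V x] is the antisymmetric part [DV - DV^T] of the Jacobian of [V], so
   that [spin V x *m v = curl V x \times v]. *)
Definition spin (R : realType) (V : 'rV[R]_3 -> 'rV[R]_3) (i k : 'I_3) (x : 'rV[R]_3) : R :=
  partial k (fun y => V y 0 i) x - partial i (fun y => V y 0 k) x.

(** * Traces in the frame and the divergence of the extended field *)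

Lemma sum_frame (R : realType) (a b e : R) (w u v z : 'rV[R]_3) (f : 'I_3 -> R) :
  (forall i, f i = a * u 0 i + b * v 0 i + e * z 0 i) ->
  \sum_(i < 3) w 0 i * f i = a * dot w u + b * dot w v + e * dot w z.
Proof. by move=> fE; rewrite sum3 !fE !dotE; ring. Qed.

(** The trace does not depend on the orthonormal basis: the Kronecker symbol is replaced by
    [frame_resolution]. *)
Lemma trace_frame (R : realType) (M : 'I_3 -> 'I_3 -> R) (t p : R) :
  \sum_(i < 3) M i i =
  \sum_(i < 3) e_r t p 0 i * \sum_(j < 3) e_r t p 0 j * M i j
  + \sum_(i < 3) e_theta t p 0 i * \sum_(j < 3) e_theta t p 0 j * M i j
  + \sum_(i < 3) e_phi p 0 i * \sum_(j < 3) e_phi p 0 j * M i j.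
Proof.
transitivity (\sum_(i < 3) \sum_(j < 3) (i == j)%:R * M i j).
  apply: eq_bigr => i _; rewrite (bigD1 i)//= eqxx mul1r big1 ?addr0// => j ji.
  by rewrite eq_sym (negbTE ji) mul0r.
under eq_bigr do under eq_bigr do rewrite -(frame_resolution t p).
by rewrite !sum3; move: (e_r t p) (e_theta t p) (e_phi p) => *; ring.
Qed.

(** Since [M^T x = - w] with [w] orthogonal to [x], the quadratic form of [M] vanishes at [x], hence
    at [e]. This removes the radial part of the divergence. *)
Lemma radial_trace0 (R : realType) (M : 'I_3 -> 'I_3 -> R) (x w e : 'rV[R]_3) (r : R) :
  r != 0 -> x = r *: e -> dot w x = 0 ->
  (forall j, \sum_(i < 3) x 0 i * M i j = - w 0 j) ->
  \sum_(i < 3) e 0 i * \sum_(j < 3) e 0 j * M i j = 0.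
Proof.
move=> r0 xE wx Mt.
have x0 i : x 0 i = r * e 0 i by rewrite xE mxE.
apply: (mulfI r0); apply: (mulfI r0); rewrite !mulr0 -[RHS]oppr0 -[X in _ = - X]wx.
transitivity (\sum_(j < 3) x 0 j * \sum_(i < 3) x 0 i * M i j).
  by rewrite !sum3 !x0; ring.
by under eq_bigr do rewrite Mt; rewrite sum3 dotE; ring.
Qed.

Section SlipBoundary.
Variables (R : realType) (h : R -> R) (g : R * R -> R) (u0 : 'rV[R]_3 -> 'rV[R]_3).
Hypotheses (Hh : radial_profile h) (Hg : angular_profile g)
  (Hu : slip_field h g u0).

Local Notation U := (slip_extension h u0).
Local Notation dU i v x := ('D_v (fun y => U y 0 i) x).

(** Near the axis the field is zero. Elsewhere the radial diagonal entry vanishes and the two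
    tangential ones cancel, as for any field derived from a stream function on the spheres. *)
Lemma extension_div0 x : div U x = 0.
Proof.
have [[phi0 Dx]|xE] := chart_cover x; last first.
  have [E [oE Ex U0]] := extension_axis_nbhs Hh Hg Hu xE.
  rewrite /div big1// => i _; rewrite /partial -(derive_cst (0 : R) x (delta_mx 0 i)).
  by apply: near_eq_derive; apply: (near_open oE Ex) => y /U0 ->; rewrite mxE.
have r0 := chart_enorm_gt0 Dx.
have xE := chartK Dx.
set r := enorm x in r0 xE; set t := chart_theta phi0 x in xE.
set p := chart_phi phi0 x in xE.
have tI : 0 < t < pi by exact: chart_theta_itv.
have st : 0 < sin t by exact: sin_gt0_pi.
pose M i j := partial j (fun y => U y 0 i) x.
have dM i (v : 'rV[R]_3) : \sum_(j < 3) v 0 j * M i j = dU i v x.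
  by rewrite derive_coordinates//; exact: (extension_diff Hh Hg Hu).
have [[err ett epp] [ert erp etp]] := frame_dot t p.
have Er : \sum_(i < 3) e_r t p 0 i * \sum_(j < 3) e_r t p 0 j * M i j = 0.
  apply: (radial_trace0 (lt0r_neq0 r0) (x := x) (w := U x)).
  - by rewrite [LHS]xE spherical_e_r.
  - exact: (extension_orthogonal Hh Hu).
  - exact: (extension_transpose Hh Hg Hu x).
have dth i : dU i (e_theta t p) x = r^-1 * dU i (r *: e_theta t p) x.
  by rewrite derive_dirZ ?mulKf ?gt_eqF//; exact: (extension_diff Hh Hg Hu).
have dph i : dU i (e_phi p) x = (r * sin t)^-1 * dU i (r * sin t *: e_phi p) x.
  by rewrite derive_dirZ ?mulKf ?gt_eqF ?mulr_gt0//; exact: (extension_diff Hh Hg Hu).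
have Eth : \sum_(i < 3) e_theta t p 0 i * dU i (r *: e_theta t p) (spherical r t p) =
    h r * (cos t / sin t ^+ 2 * d_phi g t p -
      (sin t)^-1 * d_theta (fun z => d_phi g z.1 z.2) t p).
  apply: (etrans (sum_frame _ (extension_derive_theta Hh Hg Hu p (ltW r0) tI))).
  by rewrite ett etp dotC ert !mulr0 !addr0 mulr1.
have Eph : \sum_(i < 3) e_phi p 0 i * dU i (r * sin t *: e_phi p) (spherical r t p) =
    h r * d_phi (fun z => d_theta g z.1 z.2) t p - h r / sin t * d_phi g t p * cos t.
  apply: (etrans (@sum_frame _
    (h r * d_phi (fun z => d_theta g z.1 z.2) t p - h r / sin t * d_phi g t p * cos t)
    (- (h r / sin t * d_phi (fun z => d_phi g z.1 z.2) t p) - h r * d_theta g t p * cos t)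
    (- (h r * d_theta g t p * sin t)) _ (e_phi p) (e_theta t p) (e_r t p) _ _)).
    move=> i; rewrite (extension_derive_phi Hh Hg Hu p (ltW r0) tI i).
    move: (d_phi g t p) (d_theta g t p) (d_phi _ t p) (d_phi _ t p) (h r) (cos t)
      (e_r t p 0 i) (e_theta t p 0 i) (e_phi p 0 i) => *; ring.
  by rewrite epp dotC etp dotC erp !mulr0 !addr0 mulr1.
rewrite -xE in Eth Eph.
transitivity (\sum_(i < 3) M i i) => //.
have Eth' : \sum_(i < 3) e_theta t p 0 i * \sum_(j < 3) e_theta t p 0 j * M i j =
    r^-1 * (\sum_(i < 3) e_theta t p 0 i * dU i (r *: e_theta t p) x).
  by rewrite [RHS]mulr_sumr; apply: eq_bigr => i _; rewrite dM dth mulrCA.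
have Eph' : \sum_(i < 3) e_phi p 0 i * \sum_(j < 3) e_phi p 0 j * M i j =
    (r * sin t)^-1 * (\sum_(i < 3) e_phi p 0 i * dU i (r * sin t *: e_phi p) x).
  by rewrite [RHS]mulr_sumr; apply: eq_bigr => i _; rewrite dM dph mulrCA.
rewrite (trace_frame M t p) Er add0r.
rewrite (etrans Eth' (congr1 _ Eth)).
rewrite (etrans Eph' (congr1 _ Eph)).
(* Equality of the mixed derivatives of [g] is what makes the two tangential entries cancel. *)
rewrite -(angular_mixed Hg p tI).
move: (d_phi g t p) (d_theta _ t p) (h r) (cos t) => *.
by field; rewrite !gt_eqF.
Qed.

End SlipBoundary.

(* Differentiates [f . n = 0] along the great circle through [x] directed by [v]. *)
Lemma sphere_tangent_derivative (R : realType) (f : 'I_3 -> 'rV[R]_3 -> R)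
    (x v : 'rV[R]_3) : Gamma x -> dot v x = 0 ->
  (forall k y, differentiable (f k) y) ->
  (forall y, Gamma y -> \sum_(k < 3) f k y * y 0 k = 0) ->
  \sum_(k < 3) ('D_v (f k) x * x 0 k + f k x * v 0 k) = 0.
Proof.
move=> x1 vx df f0.
(* The great circle needs a unit direction: [v] is normalised below, which sets apart the trivial
   case [v = 0]. *)
have [v0|vn0] := eqVneq (enorm v) 0.
  move/enorm_eq0 : v0 => ->; rewrite big1// => k _.
  by rewrite derive0 mxE mulr0 mul0r addr0.
pose w := (enorm v)^-1 *: v.
have xx : dot x x = 1 by rewrite -enorm_sqr x1 expr1n.
have ww : dot w w = 1.
  rewrite -enorm_sqr enormZ normfV (ger0_norm (enorm_ge0 _)) mulVf//.
  by rewrite expr1n.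
have wx : dot w x = 0.
  by transitivity ((enorm v)^-1 * dot v x); [rewrite !dotE !mxE; ring|rewrite vx mulr0].
pose c (s : R) : 'rV[R]_3 := cos s *: x + sin s *: w.
have cG s : Gamma (c s).
  rewrite /Gamma/= /enorm (_ : dot _ _ = 1) ?sqrtr1//.
  transitivity (cos s ^+ 2 * dot x x + sin s ^+ 2 * dot w w + 2 * cos s * sin s * dot w x).
    by rewrite !dotE ![c s 0 _]mxE ![(_ *: x) 0 _]mxE ![(_ *: w) 0 _]mxE; ring.
  by rewrite xx ww wx !mulr1 mulr0 addr0 cos2Dsin2.
have c0 : c 0 = x by rewrite /c cos0 sin0 scale1r scale0r addr0.
have dc j : is_derive (0 : R) 1 (fun s => c s 0 j) (w 0 j).
  have E : (fun s => c s 0 j) = fun s => cos s * x 0 j + sin s * w 0 j.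
    by apply/funext => s; rewrite [LHS]mxE [X in X + _ = _]mxE [X in _ + X = _]mxE.
  rewrite E.
  have d := is_derive_add
    (is_derive_mul (is_derive_cos1 0) (@is_derive_const R R (x 0 j) 0 1))
    (is_derive_mul (is_derive_sin1 0) (@is_derive_const R R (w 0 j) 0 1)).
  by apply: (is_derive_eq d); rewrite sin0 cos0 oppr0 !mulr0 mul0r mul1r !addr0 add0r.
have dfc k : is_derive (0 : R) 1 (fun s => f k (c s) * c s 0 k)
    ('D_w (f k) x * x 0 k + f k x * w 0 k).
  have := is_derive_mul (@is_derive_along R _ (f k) c w 0 (df k _) dc) (dc k).
  by rewrite c0.
have d := is_derive_add (is_derive_add (dfc 0) (dfc 1)) (dfc 2%:R).
have E : (fun s => f 0 (c s) * c s 0 0 + f 1 (c s) * c s 0 1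
    + f 2%:R (c s) * c s 0 2%:R) = cst 0.
  by apply/funext => s; rewrite -(f0 _ (cG s)) sum3.
rewrite E in d; have [_] := d; rewrite derive_cst => {}d.
apply: (mulfI (invr_neq0 vn0)); rewrite mulr0 [RHS]d sum3.
have dw k : 'D_w (f k) x = (enorm v)^-1 * 'D_v (f k) x.
  by rewrite derive_dirZ//; exact: df.
rewrite !dw /w ![(_ *: v) 0 _]mxE.
move: ('D_v (f 0) x) ('D_v (f 1) x) ('D_v (f 2%:R) x) (f 0 x) (f 1 x) (f 2%:R x) => *.
ring.
Qed.

Lemma spin_antisym (R : realType) (V : 'rV[R]_3 -> 'rV[R]_3) i k x :
  spin V i k x = - spin V k i x.
Proof. by rewrite /spin opprB. Qed.

Lemma antisym_quadratic (R : realType) (M : 'I_3 -> 'I_3 -> R) (v w : 'rV[R]_3) :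
  \sum_(i < 3) \sum_(k < 3) v 0 i * (M i k - M k i) * w 0 k =
  \sum_(i < 3) v 0 i * \sum_(k < 3) w 0 k * M i k
  - \sum_(i < 3) w 0 i * \sum_(k < 3) v 0 k * M i k.
Proof. by rewrite !sum3; ring. Qed.

(** * Vorticity of the datum on the sphere *)

Section SlipTwist.
Variables (R : realType) (h : R -> R) (g : R * R -> R) (u0 : 'rV[R]_3 -> 'rV[R]_3).
Hypotheses (Hh : radial_profile h) (Hg : angular_profile g)
  (Hu : slip_field h g u0).

Local Notation U := (slip_extension h u0).
Local Notation dU i v x := ('D_v (fun y => U y 0 i) x).

Lemma extension_spin_normal (x : 'rV[R]_3) i : Gamma x ->
  \sum_(k < 3) spin U i k x * x 0 k = 0.
Proof.
move=> x1; rewrite /spin; under eq_bigr do rewrite mulrC mulrBr.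
rewrite big_split/= sumrN (extension_ray Hh Hg Hu _ x1).
by rewrite (extension_transpose Hh Hg Hu) opprK addNr.
Qed.

(** Reduces the entries of the spin in the frame to the directional derivatives already computed. *)
Lemma spin_quadratic (x v w : 'rV[R]_3) :
  \sum_(i < 3) \sum_(k < 3) v 0 i * spin U i k x * w 0 k =
  \sum_(i < 3) v 0 i * dU i w x - \sum_(i < 3) w 0 i * dU i v x.
Proof.
have dM i (z : 'rV[R]_3) : dU i z x =
    \sum_(j < 3) z 0 j * partial j (fun y => U y 0 i) x.
  by rewrite derive_coordinates//; exact: (extension_diff Hh Hg Hu).
under [X in _ = X - _]eq_bigr do rewrite dM.
under [X in _ = _ - X]eq_bigr do rewrite dM.
exact: (antisym_quadratic (fun i k => partial k (fun y => U y 0 i) x)).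
Qed.

Lemma G_ofE (theta phi : R) : 0 < theta < pi -> G_of g theta phi =
  cos theta * d_theta g theta phi
  + sin theta * d_theta (fun z => d_theta g z.1 z.2) theta phi
  + (sin theta)^-1 * d_phi (fun z => d_phi g z.1 z.2) theta phi.
Proof.
move=> th; have zD := angular_stripP phi th.
rewrite /G_of; congr (_ + _); rewrite {1}/d_theta derive_fst /=.
have dgt : is_derive theta 1 (fun t => d_theta g t phi)
    (d_theta (fun z => d_theta g z.1 z.2) theta phi) :=
  is_derive_fst (smooth_on_diff (d_theta_smooth Hg 0) zD).
by have [_ ->] := is_derive_mul (is_derive_sin1 theta) dgt.
Qed.

(** Since [e_theta] times [e_phi] is [e_r], the left side is [sin theta] times the radial component
    of the vorticity. The factor [sin theta] turns [e_phi] into the velocity of a parallel of the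
    unit sphere. *)
Lemma extension_spin_frame (theta phi : R) : 0 < theta < pi ->
  \sum_(i < 3) \sum_(k < 3) (sin theta *: e_phi phi) 0 i
      * spin U i k (e_r theta phi) * e_theta theta phi 0 k
  = h 1 * G_of g theta phi.
Proof.
move=> tI; rewrite spin_quadratic /e_r.
have [[err ett epp] [ert erp etp]] := frame_dot theta phi.
have st : sin theta != 0 by rewrite gt_eqF// sin_gt0_pi.
have Eth : \sum_(i < 3) (sin theta *: e_phi phi) 0 i
     * dU i (e_theta theta phi) (spherical 1 theta phi) =
    sin theta * h 1 * d_theta (fun z => d_theta g z.1 z.2) theta phi.
  have := sum_frame (e_phi phi) (extension_derive_theta Hh Hg Hu phi ler01 tI).
  rewrite dotC etp dotC erp epp !mulr0 !add0r mulr1 scale1r => E.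
  rewrite -mulrA -E mulr_sumr; apply: eq_bigr => i _.
  by rewrite [X in X * _ = _]mxE mulrA.
have Eph : \sum_(i < 3) e_theta theta phi 0 i
     * dU i (sin theta *: e_phi phi) (spherical 1 theta phi) =
    - (h 1 / sin theta * d_phi (fun z => d_phi g z.1 z.2) theta phi)
    - h 1 * d_theta g theta phi * cos theta.
  apply: (etrans (@sum_frame _
    (h 1 * d_phi (fun z => d_theta g z.1 z.2) theta phi
      - h 1 / sin theta * d_phi g theta phi * cos theta)
    (- (h 1 / sin theta * d_phi (fun z => d_phi g z.1 z.2) theta phi)
      - h 1 * d_theta g theta phi * cos theta)
    (- (h 1 * d_theta g theta phi * sin theta)) (e_theta theta phi)
    (e_phi phi) (e_theta theta phi) (e_r theta phi) _ _)).
    move=> i; have := extension_derive_phi Hh Hg Hu phi ler01 tI i; rewrite mul1r => ->.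
    move: (d_phi g theta phi) (d_theta g theta phi) (d_phi _ theta phi)
      (d_phi _ theta phi) (h 1) (cos theta) (e_r theta phi 0 i)
      (e_theta theta phi 0 i) (e_phi phi 0 i) => *; ring.
  by rewrite etp ett dotC ert !mulr0 addr0 add0r mulr1.
apply: (etrans (congr2 (fun a b => a - b) Eth Eph)); rewrite G_ofE//.
move: (d_theta g theta phi) (d_theta _ theta phi) (d_phi _ theta phi) (h 1) => *.
by ring.
Qed.

(** With [U = - P e_theta + Q e_phi] and [A] antisymmetric, the products of [A U] with [e_phi] and
    [e_theta] isolate [P] and [Q], each times the nonzero number [h 1 * G]. If [A U] vanished, both
    derivatives of [g] would vanish at the point. *)
Lemma extension_twist : exists2 x : 'rV[R]_3, Gamma x &
  exists i, \sum_(k < 3) spin U i k x * U x 0 k != 0.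
Proof.
have [_ _ _ [theta [phi [tI G0 grad0]]]] := Hg.
have [_ _ _ h1] := Hh.
exists (e_r theta phi); first by rewrite /Gamma/= enorm_spherical.
apply/existsP; rewrite -[X in is_true X]negbK negb_exists; apply/negP => /forallP Z.
have {}Z i : \sum_(k < 3) spin U i k (e_r theta phi) * U (e_r theta phi) 0 k = 0.
  by apply/eqP; have := Z i; rewrite negbK.
have st : sin theta != 0 by rewrite gt_eqF// sin_gt0_pi.
pose P := h 1 / sin theta * d_phi g theta phi.
pose Q := h 1 * d_theta g theta phi.
have UE k : U (e_r theta phi) 0 k = - P * e_theta theta phi 0 k + Q * e_phi phi 0 k.
  by rewrite /e_r (extension_spherical Hh Hu) ?ler01// slip_formulaE.
have FG := extension_spin_frame phi tI.
have K0 : h 1 * G_of g theta phi != 0 by rewrite mulf_neq0.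
move: FG Z; pose A i k := spin U i k (e_r theta phi).
rewrite -/A; have As i k : A i k = - A k i by exact: spin_antisym.
have A0 i : A i i = 0 by have := As i i; lra.
have spinE i k : spin U i k (e_r theta phi) = A i k by [].
move=> FG Z.
have {}FG : \sum_(i < 3) \sum_(k < 3) (sin theta *: e_phi phi) 0 i * A i k
    * e_theta theta phi 0 k = h 1 * G_of g theta phi := FG.
have {}Z i : \sum_(k < 3) A i k * (- P * e_theta theta phi 0 k + Q * e_phi phi 0 k) = 0.
  by rewrite -[RHS](Z i); apply: eq_bigr => k _; rewrite UE.
clearbody A => {spinE}.
have {}FG : h 1 * G_of g theta phi = \sum_(i < 3) \sum_(k < 3)
    sin theta * e_phi phi 0 i * A i k * e_theta theta phi 0 k.
  by rewrite -FG; apply: eq_bigr => i _; apply: eq_bigr => k _; rewrite [X in X * _ * _ = _]mxE.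
move: K0; rewrite FG => K0.
have comb (w : 'rV[R]_3) : \sum_(i < 3) sin theta * w 0 i *
    (\sum_(k < 3) A i k * (- P * e_theta theta phi 0 k + Q * e_phi phi 0 k)) = 0.
  by rewrite big1// => i _; rewrite Z mulr0.
have asym := (A0, As 1 0, As 2%:R 0, As 2%:R 1).
(* Pairing with [e_phi] removes the [Q] term by antisymmetry. *)
have PK : P = 0.
  apply: (mulIf K0); rewrite mul0r -[RHS]oppr0 -[X in - X](comb (e_phi phi)).
  rewrite !sum3 !asym.
  move: (A 0 1) (A 0 2%:R) (A 1 2%:R) (e_phi phi) (e_theta theta phi) (P) (Q) => *; ring.
(* Pairing with [e_theta] removes the [P] term. *)
have QK : Q = 0.
  apply: (mulIf K0); rewrite mul0r -[RHS]oppr0 -[X in - X](comb (e_theta theta phi)).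
  rewrite !sum3 !asym.
  move: (A 0 1) (A 0 2%:R) (A 1 2%:R) (e_phi phi) (e_theta theta phi) (P) (Q) => *; ring.
case: grad0 => /eqP; apply.
  by apply: (mulfI (mulf_neq0 h1 (invr_neq0 st))); rewrite mulr0.
by apply: (mulfI h1); rewrite mulr0.
Qed.

End SlipTwist.

(** * Boundary values of functions smooth up to the boundary *)

Section Rays.
Variables (R : realType) (V : normedModType R).
Implicit Types (A D : set V) (z v w : V).

Lemma near_right_lt (s0 : R) : 0 < s0 -> \forall s \near 0^'+, (0 < s < s0 : Prop).
Proof.
move=> s00; near=> s; apply/andP; split; near: s.
  exact: nbhs_right_gt.
exact: nbhs_right_lt.
Unshelve. all: by end_near. Qed.

Lemma ray_cvg A (f : V -> R) z w (s0 : R) : {within A, continuous f} -> A z ->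
  0 < s0 -> (forall s, 0 < s < s0 -> A (z + s *: w)) ->
  f (z + s *: w) @[s --> 0^'+] --> f z.
Proof.
move=> /subspace_continuousP cf Az s00 As.
apply/cvgrPdist_le => e e0.
have /near_parallelogram-/(_ w 0)[s1 s10 P] :
    nbhs z (fun y => A y -> `|f z - f y| <= e).
  by have /cvgrPdist_le/(_ e e0) := cf z Az.
have := near_right_lt s00; apply: filter_app.
have := near_right_lt s10; apply: filterS => s /andP[sgt0 ss1] ss0.
have s00' : 0 <= s <= s1 by rewrite !ltW.
have s01 : 0 <= (0 : R) <= s1 by rewrite lexx ltW.
by have := P s 0 s00' s01; rewrite scale0r addr0; apply; exact: As.
Qed.

Lemma continuous_ray_cvg (f : V -> R) z w : {for z, continuous f} ->
  f (z + s *: w) @[s --> 0^'+] --> f z.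
Proof.
move=> cf; apply/cvgrPdist_le => e e0.
have /near_parallelogram-/(_ w 0)[s1 s10 P] : nbhs z (fun y => `|f z - f y| <= e).
  by have /cvgrPdist_le/(_ e e0) := cf.
have := near_right_lt s10; apply: filterS => s /andP[sgt0 ss1].
have s00' : 0 <= s <= s1 by rewrite !ltW.
have s01 : 0 <= (0 : R) <= s1 by rewrite lexx ltW.
by have := P s 0 s00' s01; rewrite scale0r addr0.
Qed.

(* Mean value estimate on a segment [z, z + s v] lying in the closure of [D]
   only: it is the limit of the translated segments [z + l w + [0, s v]]. *)
Lemma segment_estimate D (f f' : V -> R) z v w (s l0 L e : R) :
  {within closure D, continuous f} -> 0 < s -> 0 < l0 ->
  (forall l a, 0 < l < l0 -> 0 <= a <= s ->
    [/\ D (z + l *: w + a *: v),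
        is_derive (z + l *: w + a *: v) v f (f' (z + l *: w + a *: v)) &
        `|f' (z + l *: w + a *: v) - L| <= e]) ->
  `|f (z + s *: v) - f z - s * L| <= s * e.
Proof.
move=> cf s0 l00 H.
have s00 : 0 <= (0 : R) <= s by rewrite lexx ltW.
have s0s : 0 <= s <= s by rewrite lexx ltW.
have D0 l : 0 < l < l0 -> D (z + l *: w).
  by move=> lI; have [] := H l 0 lI s00; rewrite scale0r addr0.
have Ds l : 0 < l < l0 -> D (z + s *: v + l *: w).
  by move=> lI; have [] := H l s lI s0s; rewrite addrAC.
have sub := @subset_closure _ D.
have c0 : f (z + l *: w) @[l --> 0^'+] --> f z.
  by apply: (ray_cvg cf (closure_ray l00 D0) l00) => l /D0/sub.
have cs : f (z + s *: v + l *: w) @[l --> 0^'+] --> f (z + s *: v).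
  by apply: (ray_cvg cf (closure_ray l00 Ds) l00) => l /Ds/sub.
have cn : `|f (z + s *: v + l *: w) - f (z + l *: w) - s * L| @[l --> 0^'+] -->
    `|f (z + s *: v) - f z - s * L|.
  by apply: cvg_norm; apply: cvgB; [exact: cvgB|exact: cvg_cst].
apply: (cvgr_to_le cn).
have := near_right_lt l00; apply: filterS => l lI.
have [t tI|t /andP[t0 ts] E] := @MVT_line R V f f' (z + l *: w) v s s0.
  by have [] := H l t lI tI.
rewrite [z + s *: v + _]addrAC E -mulrBr normrM gtr0_norm// ler_wpM2l ?(ltW s0)//.
have tI : 0 <= t <= s by rewrite !ltW.
by have [] := H l t lI tI.
Qed.

Lemma right_derivative_le (F : V -> R) z v (s0 L e : R) : derivable F z v -> 0 < s0 ->
  (forall s, 0 < s < s0 -> `|F (z + s *: v) - F z - s * L| <= s * e) ->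
  `|'D_v F z - L| <= e.
Proof.
move=> dF s00 H.
have c1 : (s^-1 *: (F (z + s *: v) - F z)) @[s --> 0^'+] --> 'D_v F z.
  have : (s^-1 *: ((F \o shift z) (s *: v) - F z)) @[s --> 0^'] --> 'D_v F z := dF.
  move=> /cvg_dnbhs_at_right; apply: cvg_trans; apply: near_eq_cvg.
  by apply: nearW => s /=; rewrite [z + _]addrC.
have cn : `|s^-1 *: (F (z + s *: v) - F z) - L| @[s --> 0^'+] --> `|'D_v F z - L|.
  by apply: cvg_norm; apply: cvgB => //; exact: cvg_cst.
apply: (cvgr_to_le cn).
have := near_right_lt s00; apply: filterS => s /[dup] /H + /andP[sgt0 _].
have sn0 : s != 0 by rewrite gt_eqF.
move=> h; rewrite -(ler_pM2l sgt0) -[X in X * `|_|](gtr0_norm sgt0) -normrM.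
by rewrite mulrBr [_ *: _]/(_ * _) mulrA divff// mul1r.
Qed.

End Rays.

Section WithinContinuity.
Variables (R : realType) (V : normedModType R) (A : set V).
Implicit Types (f g : V -> R).

Lemma within_continuousD f g : {within A, continuous f} ->
  {within A, continuous g} -> {within A, continuous (fun x => f x + g x)}.
Proof. by move=> cf cg x; apply: continuousD; [exact: cf|exact: cg]. Qed.

Lemma within_continuousM f g : {within A, continuous f} ->
  {within A, continuous g} -> {within A, continuous (fun x => f x * g x)}.
Proof. by move=> cf cg x; apply: continuousM; [exact: cf|exact: cg]. Qed.

Lemma within_continuousN f : {within A, continuous f} ->
  {within A, continuous (fun x => - f x)}.
Proof. by move=> cf x; apply: continuousN; exact: cf. Qed.

Lemma within_continuous_sum (n : nat) (F : 'I_n -> V -> R) :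
  (forall i, {within A, continuous (F i)}) ->
  {within A, continuous (fun x => \sum_(i < n) F i x)}.
Proof.
elim: n F => [|n IH] F cF.
  under eq_fun do rewrite big_ord0.
  by apply: continuous_subspaceT => x; exact: cvg_cst.
under eq_fun do rewrite big_ord_recr.
by apply: within_continuousD => //; apply: IH => i.
Qed.

Lemma within_continuous_cst (c : R) : {within A, continuous (fun _ : V => c)}.
Proof. by apply: continuous_subspaceT => x; exact: cvg_cst. Qed.

End WithinContinuity.

(** Choice turns the continuous extensions promised by [Ck_closure] into functions of the
    directions, so that derivatives have values on the boundary. *)
Lemma Ck_closure2_derivatives (R : realType) (V : normedModType R) (D : set V)
    (f : V -> R) : Ck_closure D 2 f ->
  exists d1 : V -> V -> R, exists d2 : V -> V -> V -> R,
  [/\ {within closure D, continuous f},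
      forall v, {within closure D, continuous (d1 v)},
      forall v w, {within closure D, continuous (d2 v w)},
      forall v x, D x -> is_derive x v f (d1 v x) &
      forall v w x, D x -> is_derive x w (d1 v) (d2 v w x)].
Proof.
move=> [cf df].
have /choice[d1 Hd1] : forall v, exists g, Ck_closure D 1 g /\
    forall x, D x -> is_derive x v f (g x).
  by move=> v; have [g sg dg] := df v; exists g.
have /choice[d2 Hd2] : forall vw : V * V, exists g, Ck_closure D 0 g /\
    forall x, D x -> is_derive x vw.2 (d1 vw.1) (g x).
  move=> [v w]; have [[_ dg] _] := Hd1 v.
  by have [k sk dk] := dg w; exists k.
exists d1, (fun v w => d2 (v, w)); split => //.
- by move=> v; have [[]] := Hd1 v.
- by move=> v w; have [[]] := Hd2 (v, w).
- by move=> v x Dx; have [_] := Hd1 v; exact.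
- by move=> v w x Dx; have [_] := Hd2 (v, w); exact.
Qed.

Lemma cvg_right_eq (R : realType) (f k : R -> R) (l m s0 : R) : 0 < s0 ->
  (forall s, 0 < s < s0 -> f s = k s) ->
  f s @[s --> 0^'+] --> l -> k s @[s --> 0^'+] --> m -> l = m.
Proof.
move=> s00 fk cf ck.
have fkn : \forall s \near 0^'+, k s = f s.
  by have := near_right_lt s00; apply: filterS => s /fk.
have cm : f s @[s --> 0^'+] --> m.
  by apply: cvg_trans ck; apply: near_eq_cvg.
exact: (cvg_unique (@Rhausdorff R) cf cm).
Qed.

(** * The space-time cylinder and its initial face *)

Section SpaceTime.
Variable (R : realType).
Local Notation V := (R * 'rV[R]_3)%type.
Implicit Types (t T : R) (x e : 'rV[R]_3).

Definition time_dir : V := (1, 0).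

Definition space_dir (j : 'I_3) : V := (0, delta_mx 0 j).

Definition cylinder T : set V := `]0, T[%classic `*` @Omega R.

Lemma cylinder_open T : open (cylinder T).
Proof. by apply: open_prod; [exact: itv_open|exact: Omega_open]. Qed.

Lemma cylinderP T t x : cylinder T (t, x) <-> 0 < t < T /\ enorm x < 1.
Proof. by rewrite /cylinder/= in_itv/=. Qed.

Lemma space_timeE t x (a b : R) e :
  (t, x) + a *: ((1, 0) : V) + b *: ((0, e) : V) = (t + a, x + b *: e).
Proof.
rewrite [LHS]surjective_pairing/=; congr (_, _); last by rewrite scaler0 addr0.
by rewrite [a *: 1]mulr1 [b *: 0]mulr0 addr0.
Qed.

Lemma inward_rayE t x (s : R) :
  (t, x) + s *: ((1, - x) : V) = (t + s, (1 - s) *: x).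
Proof.
rewrite [LHS]surjective_pairing/=; congr (_ + _, _); first by rewrite [_ *: _]mulr1.
by rewrite scalerN scalerBl scale1r.
Qed.

Lemma enorm_shrink x (s : R) : enorm x <= 1 -> 0 < s < 1 -> enorm ((1 - s) *: x) < 1.
Proof.
move=> x1 /andP[s0 s1]; rewrite enormZ gtr0_norm ?subr_gt0//.
by rewrite (le_lt_trans (ler_wpM2l _ x1))// ?subr_ge0 ?ltW// mulr1 ltrBlDr ltrDl.
Qed.

(** The direction [(1, - x)] raises the time and contracts the position, so it leaves the initial
    face and the lateral boundary simultaneously. *)
Lemma cylinder_ray T t x : 0 <= t < T -> enorm x <= 1 ->
  exists2 s0 : R, 0 < s0 &
    forall s, 0 < s < s0 -> cylinder T ((t, x) + s *: ((1, - x) : V)).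
Proof.
move=> /andP[t0 tT] x1; exists (Num.min 1 (T - t)).
  by rewrite lt_min ltr01 subr_gt0.
move=> s /andP[s0]; rewrite lt_min => /andP[s1 sT].
rewrite inward_rayE; apply/cylinderP; split.
  by apply/andP; split; lra.
by apply: enorm_shrink; rewrite ?s0.
Qed.

Lemma closure_cylinder T t x : 0 <= t < T -> enorm x <= 1 -> closure (cylinder T) (t, x).
Proof.
by move=> tI x1; have [s0 s00 H] := cylinder_ray tI x1; exact: closure_ray s00 H.
Qed.

(** Carries identities from the interior, where the equation holds, to time zero and to the
    sphere. *)
Lemma cylinder_zero_closure T (f : V -> R) t x : {within closure (cylinder T), continuous f} ->
  (forall z, cylinder T z -> f z = 0) -> 0 <= t < T -> enorm x <= 1 -> f (t, x) = 0.
Proof.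
move=> cf f0 tI x1; have [s0 s00 H] := cylinder_ray tI x1.
have c := ray_cvg cf (closure_cylinder tI x1) s00
  (fun s sI => subset_closure (H s sI)).
by apply: (cvg_right_eq s00 _ c (cvg_cst (0 : R))) => s /H/f0.
Qed.

(** The ray of direction [(0, - x)] stays in the initial face and reaches the open ball at once. *)
Lemma initial_closure T (f : V -> R) (F : 'rV[R]_3 -> R) x : 0 < T ->
  {within closure (cylinder T), continuous f} -> continuous F ->
  (forall y, Omega y -> f (0, y) = F y) -> enorm x <= 1 -> f (0, x) = F x.
Proof.
move=> T0 cf cF fF x1.
have T00 : 0 <= (0 : R) < T by rewrite lexx.
have rE s : (0, x) + s *: ((0, - x) : V) = (0, (1 - s) *: x).
  rewrite [LHS]surjective_pairing/=; congr (_, _).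
    by rewrite [_ *: _]mulr0 addr0.
  by rewrite scalerN scalerBl scale1r.
have c := ray_cvg cf (closure_cylinder T00 x1) ltr01 (w := (0, - x)).
have {}c : f ((0, x) + s *: ((0, - x) : V)) @[s --> 0^'+] --> f (0, x).
  apply: c => s sI; rewrite rE; apply: closure_cylinder => //.
  by apply/ltW/enorm_shrink.
have c' := continuous_ray_cvg (- x) (cF x).
apply: (cvg_right_eq (@ltr01 R) _ c c') => s sI.
rewrite rE fF; last exact: enorm_shrink.
by rewrite scalerN scalerBl scale1r.
Qed.

(** The extension [f'] is a derivative at positive times only. Mean value estimates on segments at
    time [l], with [l] tending to 0, bound the increments of the initial value [F] and thereby
    identify its derivative. *)
Lemma initial_derivative T (f f' : V -> R) (F : 'rV[R]_3 -> R) e x : 0 < T ->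
  {within closure (cylinder T), continuous f} ->
  {within closure (cylinder T), continuous f'} ->
  (forall z, cylinder T z -> is_derive z ((0, e) : V) f (f' z)) ->
  (forall y, Omega y -> f (0, y) = F y) -> derivable F x e -> Omega x ->
  f' (0, x) = 'D_e F x.
Proof.
move=> T0 cf cf' df fF dF Ox.
have T00 : 0 <= (0 : R) < T by rewrite lexx.
suff H r : 0 < r -> `|'D_e F x - f' (0, x)| <= r.
  apply/esym/eqP; rewrite -subr_eq0 -normr_le0; apply/ler_addgt0Pr => r r0.
  by rewrite add0r; exact: H.
move=> r0.
have n1 : nbhs ((0, x) : V) (fun z => closure (cylinder T) z -> `|f' (0, x) - f' z| <= r).
  have /subspace_continuousP/(_ _ (closure_cylinder T00 (ltW Ox))) := cf'.
  by move=> /cvgrPdist_le/(_ r r0).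
have n2 : nbhs ((0, x) : V) ([set t | t < T] `*` @Omega R).
  apply: open_nbhs_nbhs; split => //.
  by apply: open_prod; [exact: open_lt|exact: Omega_open].
have /near_parallelogram-/(_ (1, 0) (0, e))[s0 s00 P] :
    nbhs ((0, x) : V) (fun z => (closure (cylinder T) z -> `|f' (0, x) - f' z| <= r) /\
      ([set t | t < T] `*` @Omega R) z) by exact: filterI.
have zr : 0 <= (0 : R) <= s0 by rewrite lexx ltW.
apply: (@right_derivative_le R _ F x e s0) => // s /andP[sgt0 ss0].
have PI b : 0 <= b <= s -> Omega (x + b *: e).
  move=> /andP[b0 bs].
  have bI : 0 <= b <= s0 by rewrite b0 (le_trans bs)// ltW.
  by have [_ []] := P 0 b zr bI; rewrite space_timeE.
rewrite -!fF//; last by apply: PI; rewrite lexx ltW.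
have -> : (0, x + s *: e) = (0, x) + s *: ((0, e) : V).
  by have := space_timeE 0 x 0 s e; rewrite scale0r !addr0.
apply: (segment_estimate (D := cylinder T) (f' := f') (w := (1, 0)) (l0 := s0) cf) => //.
move=> l a /andP[lgt0 ls0] /andP[a0 as_].
have lI : 0 <= l <= s0 by rewrite !ltW.
have aI : 0 <= a <= s0 by rewrite a0 (le_trans as_)// ltW.
have [P1 P23] := P l a lI aI.
rewrite space_timeE add0r in P1 P23 *; case: P23 => /= P2 P3.
have C : cylinder T (l, x + a *: e) by apply/cylinderP; split; [rewrite lgt0|exact: P3].
split => //; first exact: df.
by rewrite distrC; apply: P1; exact: subset_closure.
Qed.

Lemma is_derive_space (W : normedModType R) (f : V -> W) t x e (d : W) :
  is_derive ((t, x) : V) ((0, e) : V) f d -> is_derive x e (fun y => f (t, y)) d.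
Proof.
move=> [dfx dE].
have E : (fun h : R => h^-1 *: (((fun y => f (t, y)) \o shift x) (h *: e) - f (t, x))) =
    (fun h => h^-1 *: ((f \o shift (t, x)) (h *: (0, e)) - f (t, x))).
  apply/funext => h /=; congr (_ *: (f _ - _)).
  by rewrite [RHS]surjective_pairing/= [h *: 0]mulr0 add0r.
by split; [rewrite /derivable E|rewrite -dE /derive E].
Qed.

Lemma is_derive_time (W : normedModType R) (f : V -> W) t x (d : W) :
  is_derive ((t, x) : V) time_dir f d -> is_derive t 1 (fun s => f (s, x)) d.
Proof.
move=> [dfx dE].
have E : (fun h : R => h^-1 *: (((fun s => f (s, x)) \o shift t) (h *: 1) - f (t, x))) =
    (fun h => h^-1 *: ((f \o shift (t, x)) (h *: time_dir) - f (t, x))).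
  apply/funext => h /=; congr (_ *: (f _ - _)).
  by rewrite [RHS]surjective_pairing/= scaler0 add0r.
by split; [rewrite /derivable E|rewrite -dE /derive E].
Qed.

End SpaceTime.

Lemma pair_continuous (R : realType) (t : R) (x : 'rV[R]_3) :
  {for x, continuous (fun y : 'rV[R]_3 => (t, y))}.
Proof.
apply: differentiable_continuous.
exact: (differentiable_pair (differentiable_cst t x) (@ex_diff _ _ _ _ _ _ _ (is_diff_id x))).
Qed.

(** * Vorticity of an Euler solution at time zero *)

(* [d1 v] and [d2 v w] extend the derivatives [D_v f] and [D_w D_v f] from [D]
   continuously to its closure. *)
Definition jet2 (R : realType) (V : normedModType R) (D : set V) (f : V -> R)
    (d1 : V -> V -> R) (d2 : V -> V -> V -> R) : Prop :=
  [/\ {within closure D, continuous f},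
      forall v, {within closure D, continuous (d1 v)},
      forall v w, {within closure D, continuous (d2 v w)},
      forall v x, D x -> is_derive x v f (d1 v x) &
      forall v w x, D x -> is_derive x w (d1 v) (d2 v w x)].

Lemma jet2_sym (R : realType) (V : normedModType R) (D : set V) (f : V -> R)
    d1 d2 v w x : open D -> jet2 D f d1 d2 -> D x -> d2 v w x = d2 w v x.
Proof.
move=> oD [_ _ c2 D1 D2] Dx.
apply: (schwarz (f := f) (fv := d1 v) (fw := d1 w) (v := v) (w := w)).
- by apply: (near_open oD Dx) => y Dy; exact: D1.
- by apply: (near_open oD Dx) => y Dy; exact: D1.
- by apply: (near_open oD Dx) => y Dy; exact: D2.
- by apply: (near_open oD Dx) => y Dy; exact: D2.
- exact: within_closure_continuous (c2 v w) Dx.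
- exact: within_closure_continuous (c2 w v) Dx.
Qed.

Section EulerVorticity.
Variables (R : realType) (T : R) (u : R -> 'rV[R]_3 -> 'rV[R]_3)
  (p : R -> 'rV[R]_3 -> R).
Local Notation V := (R * 'rV[R]_3)%type.
Variables (d1 : 'I_3 -> V -> V -> R) (d2 : 'I_3 -> V -> V -> V -> R).
Local Notation tau := (@time_dir R).
Local Notation sg := (@space_dir R).
Local Notation C := (@cylinder R T).
Hypothesis T0 : 0 < T.
Hypothesis J : forall i, jet2 C (fun z => u z.1 z.2 0 i) (d1 i) (d2 i).
Hypothesis Hp : forall (t : R) x, 0 < t < T -> Omega x -> differentiable (p t) x.
Hypothesis He : forall (t : R) x, 0 < t < T -> Omega x ->
  'D_1 (fun s => u s x) t + advect (u t) (u t) x + grad (p t) x = 0.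

Let oC : open C := @cylinder_open R T.

Lemma velocity_space t x i j : C (t, x) ->
  is_derive x (delta_mx 0 j) (fun y => u t y 0 i) (d1 i (sg j) (t, x)).
Proof.
move=> Cx; have [_ _ _ D1 _] := J i.
exact: (@is_derive_space R R (fun z => u z.1 z.2 0 i)) (D1 _ _ Cx).
Qed.

(** The pressure gradient as dictated by the Euler equation, expressed through the jets so that it
    makes sense up to the boundary. *)
Definition pressure_force i (z : V) : R :=
  - (d1 i tau z + \sum_(j < 3) u z.1 z.2 0 j * d1 i (sg j) z).

Definition pressure_force_derivative i k (z : V) : R :=
  - (d2 i tau (sg k) z + \sum_(j < 3) (d1 j (sg k) z * d1 i (sg j) z
     + u z.1 z.2 0 j * d2 i (sg j) (sg k) z)).

Lemma partial_pressure t x i : C (t, x) ->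
  is_derive x (delta_mx 0 i) (p t) (pressure_force i (t, x)).
Proof.
move=> Cx; have /cylinderP[tI Ox] := Cx.
have [_ _ _ D1 _] := J i.
have dp := Hp tI Ox.
have <- : partial i (p t) x = pressure_force i (t, x); last first.
  exact/derivableP/diff_derivable.
have := congr1 (fun w : 'rV[R]_3 => w 0 i) (He tI Ox).
rewrite !mxE.
have -> : 'D_1 (fun s => u s x) t 0 i = d1 i tau (t, x).
  have dt : is_derive t 1 (fun s => u s x) (\row_i d1 i tau (t, x)).
    apply: is_derive_row => j; rewrite mxE.
    have [_ _ _ D1j _] := J j.
    exact: (@is_derive_time R R (fun z => u z.1 z.2 0 j)) (D1j _ _ Cx).
  by have [_ ->] := dt; rewrite mxE.
have -> : advect (u t) (u t) x 0 i = \sum_(j < 3) u t x 0 j * d1 i (sg j) (t, x).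
  rewrite /advect summxE; apply: eq_bigr => j _; rewrite mxE; congr (_ * _).
  have dx : is_derive x (delta_mx 0 j) (u t) (\row_i d1 i (sg j) (t, x)).
    by apply: is_derive_row => k; rewrite mxE; exact: velocity_space.
  by rewrite /partial; have [_ ->] := dx; rewrite mxE.
by move=> /eqP; rewrite addrC addr_eq0 => /eqP ->.
Qed.

Lemma derive_pressure_force t x i k : C (t, x) ->
  is_derive x (delta_mx 0 k) (fun y => pressure_force i (t, y))
    (pressure_force_derivative i k (t, x)).
Proof.
move=> Cx; have [_ _ _ _ D2i] := J i.
have dT := @is_derive_space R R (d1 i tau) t x _ _ (D2i tau (sg k) _ Cx).
have dS j := is_derive_mul (velocity_space j k Cx)
  (@is_derive_space R R (d1 i (sg j)) t x _ _ (D2i (sg j) (sg k) _ Cx)).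
have d := is_derive_opp (is_derive_add dT
  (is_derive_add (is_derive_add (dS 0) (dS 1)) (dS 2%:R))).
by rewrite /pressure_force /pressure_force_derivative; under eq_fun do rewrite sum3;
  rewrite sum3.
Qed.

Lemma pressure_force_derivative_continuous i k :
  {within closure C, continuous (pressure_force_derivative i k)}.
Proof.
have [_ c1 c2 _ _] := J i.
apply: within_continuousN; apply: within_continuousD; first exact: c2.
apply: within_continuous_sum => j; have [c0 c1j _ _ _] := J j.
by apply: within_continuousD; apply: within_continuousM;
  [exact: c1j|exact: c1|exact: c0|exact: c2].
Qed.

(** The first derivatives of the pressure coincide with [pressure_force], which has continuous space
    derivatives; the symmetry of second derivatives therefore applies to a pressure assumed only
    differentiable. *)
Lemma pressure_force_curl_free i k z : C z ->
  pressure_force_derivative i k z = pressure_force_derivative k i z.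
Proof.
case: z => t x Cx; have /cylinderP[tI Ox] := Cx.
have Cy y : Omega y -> C (t, y) by move=> Oy; apply/cylinderP.
have oO := @Omega_open R.
have cs (f : V -> R) : {within closure C, continuous f} ->
    {for x, continuous (fun y => f (t, y))}.
  move=> cf; apply: (@continuous_comp _ _ _ (fun y => (t, y)) f).
    exact: pair_continuous.
  exact: within_closure_continuous cf Cx.
apply: (@schwarz R _ (p t) (fun y => pressure_force i (t, y))
  (fun y => pressure_force k (t, y))
  (fun y => pressure_force_derivative i k (t, y))
  (fun y => pressure_force_derivative k i (t, y)) x (delta_mx 0 i) (delta_mx 0 k)).
- by apply: (near_open oO Ox) => y /Cy; exact: partial_pressure.
- by apply: (near_open oO Ox) => y /Cy; exact: partial_pressure.
- by apply: (near_open oO Ox) => y /Cy; exact: derive_pressure_force.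
- by apply: (near_open oO Ox) => y /Cy; exact: derive_pressure_force.
- exact/cs/pressure_force_derivative_continuous.
- exact/cs/pressure_force_derivative_continuous.
Qed.

Section Initial.
Variable U : 'rV[R]_3 -> 'rV[R]_3.
Hypothesis HU : forall k i, smooth_on k setT (fun x => U x 0 i).
Hypothesis Hi : forall x, Omega x -> u 0 x = U x.

Let zT : 0 <= (0 : R) < T.
Proof. by rewrite lexx. Qed.

Let cU i v : continuous ('D_v (fun y => U y 0 i)).
Proof.
have s : smooth_on 0 setT ('D_v (fun y => U y 0 i)) := (HU 1 i).2 v.
by move=> x; apply: differentiable_continuous; exact: (smooth_on_diff s I).
Qed.

Lemma initial_velocity x i : enorm x <= 1 -> u 0 x 0 i = U x 0 i.
Proof.
move=> x1; have [c0 _ _ _ _] := J i.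
apply: (initial_closure (f := fun z => u z.1 z.2 0 i) (F := fun y => U y 0 i) T0 c0) => //.
  by move=> y; apply: differentiable_continuous; exact: (smooth_on_diff (HU 0 i) I).
by move=> y Oy /=; rewrite Hi.
Qed.

Lemma initial_gradient x i j : enorm x <= 1 ->
  d1 i (sg j) (0, x) = partial j (fun y => U y 0 i) x.
Proof.
move=> x1; have [c0 c1 _ D1 _] := J i.
apply: (initial_closure (F := 'D_(delta_mx 0 j) (fun y => U y 0 i)) T0 (c1 _)) => // y Oy.
apply: (initial_derivative (f := fun z => u z.1 z.2 0 i) (F := fun y => U y 0 i) T0 c0
  (c1 (sg j))) => //.
- by move=> w Ow /=; rewrite Hi.
- by apply: diff_derivable; exact: (smooth_on_diff (HU 0 i) I).
Qed.

(** A second use of [initial_derivative], now with the extended gradient as the function and its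
    initial value from [initial_gradient]. *)
Lemma initial_hessian x i j k : enorm x <= 1 ->
  d2 i (sg j) (sg k) (0, x) =
  'D_(delta_mx 0 k) ('D_(delta_mx 0 j) (fun y => U y 0 i)) x.
Proof.
move=> x1; have [c0 c1 c2 D1 D2] := J i.
have s1 v : smooth_on 1 setT ('D_v (fun y => U y 0 i)) := (HU 2 i).2 v.
have s2 v w : smooth_on 0 setT ('D_w ('D_v (fun y => U y 0 i))) := (s1 v).2 w.
apply: (initial_closure
  (F := 'D_(delta_mx 0 k) ('D_(delta_mx 0 j) (fun y => U y 0 i))) T0 (c2 _ _)) => // [y|y Oy].
  by apply: differentiable_continuous; exact: (smooth_on_diff (s2 _ _) I).
apply: (initial_derivative (f := d1 i (sg j)) T0 (c1 (sg j)) (c2 (sg j) (sg k))) => //.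

- by move=> w Ow; apply: initial_gradient; exact: ltW.
- by apply: diff_derivable; exact: (smooth_on_diff (s1 _) I).
Qed.

Lemma initial_pressure_force_curl_free x i k : enorm x <= 1 ->
  pressure_force_derivative i k (0, x) = pressure_force_derivative k i (0, x).
Proof.
move=> x1; apply/eqP; rewrite -subr_eq0; apply/eqP.
apply: (@cylinder_zero_closure R T (fun z => pressure_force_derivative i k z
  - pressure_force_derivative k i z)) => //.
  by apply: within_continuousD; [|apply: within_continuousN];
    exact: pressure_force_derivative_continuous.
by move=> z Cz; rewrite pressure_force_curl_free// subrr.
Qed.

(** The rate of the spin differentiates in space and then in time, the curl of the equation in time
    and then in space. *)
Lemma initial_time_mixed x i j : enorm x <= 1 ->
  d2 i (sg j) tau (0, x) = d2 i tau (sg j) (0, x).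
Proof.
move=> x1; apply/eqP; rewrite -subr_eq0; apply/eqP.
have [_ _ c2 _ _] := J i.
apply: (@cylinder_zero_closure R T (fun z => d2 i (sg j) tau z - d2 i tau (sg j) z)) => //.
  by apply: within_continuousD; [|apply: within_continuousN]; exact: c2.
by move=> z Cz; rewrite (jet2_sym _ _ oC (J i) Cz) subrr.
Qed.

End Initial.
End EulerVorticity.

(** Here [M] is the Jacobian, [H] the second derivatives, and the third hypothesis is the slip
    condition differentiated along [w]. The terms quadratic in [M] collapse to [M w - M^T w], and
    the transport term contributes the same vector again. *)
Lemma spin_rate_algebra (R : realType) (M : 'I_3 -> 'I_3 -> R)
    (H : 'I_3 -> 'I_3 -> 'I_3 -> R) (x w : 'rV[R]_3) i :
  (forall k, \sum_(j < 3) x 0 j * M j k = - w 0 k) ->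
  (forall k, \sum_(j < 3) x 0 j * M k j = - w 0 k) ->
  \sum_(k < 3) ((\sum_(j < 3) w 0 j * (H i j k - H k j i)) * x 0 k
    + (M i k - M k i) * w 0 k) = 0 ->
  \sum_(k < 3) (\sum_(j < 3) (M j i * M k j + w 0 j * H k j i)
    - \sum_(j < 3) (M j k * M i j + w 0 j * H i j k)) * x 0 k =
  2 * \sum_(k < 3) (M i k - M k i) * w 0 k.
Proof.
move=> Mt Mr /eqP; rewrite big_split/= addr_eq0 => /eqP E.
transitivity (\sum_(j < 3) M j i * (\sum_(k < 3) x 0 k * M k j)
  - \sum_(j < 3) M i j * (\sum_(k < 3) x 0 k * M j k)
  - \sum_(k < 3) (\sum_(j < 3) w 0 j * (H i j k - H k j i)) * x 0 k).
  by rewrite !sum3; ring.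
rewrite E; under [X in X - _ - _]eq_bigr do rewrite Mt.
under [X in _ - X - _]eq_bigr do rewrite Mr.
by rewrite !sum3; ring.
Qed.

(** An antisymmetric matrix acts as the cross product with its axial vector; indices are cyclic
    modulo 3. *)
Lemma cross_spin (R : realType) (S : 'I_3 -> 'I_3 -> R) (c x : 'rV[R]_3) i :
  (forall j k, S j k = - S k j) -> (forall j, c 0 j = S (j + 2%:R) (j + 1)) ->
  cross c x 0 i = \sum_(k < 3) S i k * x 0 k.
Proof.
move=> Sa cE; have S0 j : S j j = 0 by have := Sa j j; lra.
have [e1 e2 e3 e4] := ord3_add.
rewrite mxE !cE sum3.
elim/ord3_ind: i; rewrite ?add0r ?e1 ?e2 ?e3 ?e4 ?add0r ?e1 ?e2 ?e3 ?e4 ?add0r S0.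
- by rewrite (Sa 1 0); ring.
- by rewrite (Sa 2%:R 1); ring.
- by rewrite (Sa 0 2%:R); ring.
Qed.

Lemma curl_spin (R : realType) (F : 'rV[R]_3 -> 'rV[R]_3) x j :
  curl F x 0 j = spin F (j + 2%:R) (j + 1) x.
Proof. by rewrite mxE. Qed.

Lemma row_cvg (R : realType) (T : Type) (E : set_system T) (FE : Filter E) n
    (f : T -> 'rV[R]_n) (l : 'rV[R]_n) :
  (forall i, f y 0 i @[y --> E] --> l 0 i) -> f y @[y --> E] --> l.
Proof.
move=> fl; apply/cvgrPdist_le => e e0.
have /filter_forall : forall i, \forall y \near E, `|l 0 i - f y 0 i| <= e.
  by move=> i; have /cvgrPdist_le/(_ e e0) := fl i.
apply: filterS => y H.
rewrite [leLHS]/Num.Def.normr/= mx_normrE (bigmax_le _ (ltW e0))//= => -[i j] _.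
by rewrite ord1 !mxE; exact: H.
Qed.

Lemma trace_row (R : realType) (f : 'rV[R]_3 -> 'rV[R]_3) (l x : 'rV[R]_3) :
  enorm x <= 1 ->
  (forall i, f y 0 i @[y --> within (@Omega R) (nbhs x)] --> l 0 i) ->
  trace (@Omega R) f x = l.
Proof.
move=> x1 fl.
have PF : ProperFilter (within (@Omega R) (nbhs x)).
  by apply: within_nbhs_proper; rewrite closure_Omega.
by apply: cvg_lim; [exact: norm_hausdorff|exact: row_cvg].
Qed.

Lemma within_eq_cvg (R : realType) (V : normedModType R) (D : set V) (f F : V -> R)
    (x : V) (l : R) :
  (forall y, D y -> f y = F y) -> F y @[y --> within D (nbhs x)] --> l ->
  f y @[y --> within D (nbhs x)] --> l.
Proof.
move=> fF; apply: cvg_trans; apply: near_eq_cvg.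
by rewrite near_withinE; apply: nearW => y /fF.
Qed.

(** Replaces the trace of the curl by the value at [x] of any antisymmetric family that agrees with
    the spin inside and converges at [x]. It is used with the spin of the extended field for the
    datum, and with the jets for the solution. *)
Lemma vorticity_bcP (R : realType) (F : 'rV[R]_3 -> 'rV[R]_3)
    (S : 'I_3 -> 'I_3 -> 'rV[R]_3 -> R) (x : 'rV[R]_3) : Gamma x ->
  (forall i k y, Omega y -> spin F i k y = S i k y) ->
  (forall i k y, S i k y = - S k i y) ->
  (forall i k, S i k y @[y --> within (@Omega R) (nbhs x)] --> S i k x) ->
  forall i, cross (trace (@Omega R) (curl F) x) (normal x) 0 i =
    \sum_(k < 3) S i k x * x 0 k.
Proof.
move=> x1 FS Sa cS i.
rewrite (trace_row (l := \row_j S (j + 2%:R) (j + 1) x)).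
- by apply: (cross_spin (S := fun i k => S i k x)) => [j k|j]; [exact: Sa|rewrite mxE].
- by rewrite x1.
move=> j; rewrite mxE; apply: within_eq_cvg (cS _ _) => y Oy.
by rewrite curl_spin FS.
Qed.

(** * Initial time derivative of the spin on the sphere *)

Section SpinRate.
Variables (R : realType) (T : R) (u : R -> 'rV[R]_3 -> 'rV[R]_3)
  (p : R -> 'rV[R]_3 -> R).
Local Notation V := (R * 'rV[R]_3)%type.
Variables (d1 : 'I_3 -> V -> V -> R) (d2 : 'I_3 -> V -> V -> V -> R).
Local Notation tau := (@time_dir R).
Local Notation sg := (@space_dir R).
Local Notation C := (@cylinder R T).
Hypothesis T0 : 0 < T.
Hypothesis J : forall i, jet2 C (fun z => u z.1 z.2 0 i) (d1 i) (d2 i).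
Hypothesis Hp : forall (t : R) x, 0 < t < T -> Omega x -> differentiable (p t) x.
Hypothesis He : forall (t : R) x, 0 < t < T -> Omega x ->
  'D_1 (fun s => u s x) t + advect (u t) (u t) x + grad (p t) x = 0.
Variable U : 'rV[R]_3 -> 'rV[R]_3.
Hypothesis HU : forall k i, smooth_on k setT (fun x => U x 0 i).
Hypothesis Hi : forall x, Omega x -> u 0 x = U x.
Hypothesis Uorth : forall x, dot (U x) x = 0.
Hypothesis Utr : forall (x : 'rV[R]_3) i,
  \sum_(j < 3) x 0 j * partial i (fun y => U y 0 j) x = - U x 0 i.
Hypothesis Uray : forall (x : 'rV[R]_3) i, enorm x = 1 ->
  \sum_(j < 3) x 0 j * partial j (fun y => U y 0 i) x = - U x 0 i.
Hypothesis Uspin : forall (x : 'rV[R]_3) i, Gamma x ->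
  \sum_(k < 3) spin U i k x * x 0 k = 0.

(** The time derivative of the spin of [u], extended to the closed cylinder through the jets. *)
Definition spin_rate i k (z : V) : R := d2 i (sg k) tau z - d2 k (sg i) tau z.

(** The order of differentiation is exchanged to match the transport term of [spin_rate_algebra]. *)
Lemma derive_spin i k (v x : 'rV[R]_3) : 'D_v (spin U i k) x =
  \sum_(j < 3) v 0 j *
    ('D_(delta_mx 0 k) ('D_(delta_mx 0 j) (fun y => U y 0 i)) x
     - 'D_(delta_mx 0 i) ('D_(delta_mx 0 j) (fun y => U y 0 k)) x).
Proof.
have s1 l w : smooth_on 0 setT ('D_w (fun y => U y 0 l)) := (HU 1 l).2 w.
have ds l w : differentiable ('D_w (fun y => U y 0 l)) x := smooth_on_diff (s1 l w) I.
have dB : differentiable (spin U i k) x by exact: (differentiableB (ds i _) (ds k _)).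
rewrite (derive_coordinates _ dB); apply: eq_bigr => j _; congr (_ * _).
have dd l w z : derivable ('D_w (fun y => U y 0 l)) x z by exact/diff_derivable/ds.
rewrite [LHS](deriveB (dd i _ _) (dd k _ _)).
have sm l w := @smooth_mixed R _ setT (fun y => U y 0 l) w (delta_mx 0 j) x openT (HU 2 l) I.
exact: (congr2 (fun a b => a - b) (sm i (delta_mx 0 k)) (sm k (delta_mx 0 i))).
Qed.

Lemma initial_spin_rate (x : 'rV[R]_3) i : Gamma x ->
  \sum_(k < 3) spin_rate i k (0, x) * x 0 k =
  2 * \sum_(k < 3) spin U i k x * U x 0 k.
Proof.
move=> x1; have xle : enorm x <= 1 by rewrite x1.
have dspin k y : differentiable (spin U i k) y.
  have s1 l w : smooth_on 0 setT ('D_w (fun y => U y 0 l)) := (HU 1 l).2 w.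
  by exact: (differentiableB (smooth_on_diff (s1 i _) I) (smooth_on_diff (s1 k _) I)).
have E := sphere_tangent_derivative x1 (Uorth x) dspin (fun y => @Uspin y i).
pose M i k := partial k (fun y => U y 0 i) x.
pose H i j k := 'D_(delta_mx 0 k) ('D_(delta_mx 0 j) (fun y => U y 0 i)) x.
pose S i k := \sum_(j < 3) (M j k * M i j + U x 0 j * H i j k).
have forceE l k : pressure_force_derivative u d1 d2 l k (0, x) =
    - (d2 l tau (sg k) (0, x) + S l k).
  congr (- (_ + _)); apply: eq_bigr => j _; congr (_ * _ + _ * _).
  - exact: (initial_gradient T0 J HU Hi).
  - exact: (initial_gradient T0 J HU Hi).
  - exact: (initial_velocity T0 J HU Hi).
  - exact: (initial_hessian T0 J HU Hi).
(* The symmetry of the derivative of the pressure force eliminates the pressure and gives the time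
   derivatives in terms of the datum alone. *)
have rateE k : spin_rate i k (0, x) = S k i - S i k.
  have tm l m := initial_time_mixed T0 J l m xle.
  have ab := initial_pressure_force_curl_free T0 J Hp He i k xle.
  have {}ab := etrans (esym (forceE i k)) (etrans ab (forceE k i)).
  rewrite /spin_rate (tm i k) (tm k i).
  move: (d2 i tau (sg k) (0, x)) (d2 k tau (sg i) (0, x)) (S i k) (S k i) ab.
  by move=> a b c d /oppr_inj ab; lra.
rewrite -[RHS](spin_rate_algebra (M := M) (H := H) (x := x)).
- apply: eq_bigr => k _; congr (_ * _); exact: rateE.
- by move=> k; exact: Utr.
- by move=> k; exact: Uray.
- by rewrite -[RHS]E; apply: eq_bigr => k _; rewrite derive_spin.
Qed.

End SpinRate.

(** * Loss of the slip condition at positive times *)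

Lemma slice_cvg (R : realType) (T t : R) (f : R * 'rV[R]_3 -> R) (x : 'rV[R]_3) :
  {within closure (cylinder T), continuous f} -> 0 < t < T -> enorm x <= 1 ->
  f (t, y) @[y --> within (@Omega R) (nbhs x)] --> f (t, x).
Proof.
move=> /subspace_continuousP cf tI x1.
have tI' : 0 <= t < T by case/andP: tI => /ltW -> ->.
have Cx : closure (cylinder T) (t, x) by exact: closure_cylinder.
apply/cvgrPdist_le => e e0.
have n : nbhs (t, x) (fun z => closure (cylinder T) z -> `|f (t, x) - f z| <= e).
  by have /cvgrPdist_le/(_ e e0) := cf _ Cx.
have n' : nbhs x (fun y => closure (cylinder T) (t, y) -> `|f (t, x) - f (t, y)| <= e).
  exact: (@pair_continuous R t x _ n).
rewrite near_withinE; move: n'; apply: filterS => y H Oy.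
by apply/H/subset_closure/cylinderP.
Qed.

Lemma choose_jets (R : realType) (T : R) (u : R -> 'rV[R]_3 -> 'rV[R]_3) :
  Cinfty_closure (cylinder T) (fun z : R * 'rV[R]_3 => u z.1 z.2) ->
  exists d1 d2, forall i, jet2 (cylinder T)
    (fun z : R * 'rV[R]_3 => u z.1 z.2 0 i) (d1 i) (d2 i).
Proof.
move=> su.
have /choice[d Hd] : forall i : 'I_3, exists d, jet2 (cylinder T)
    (fun z : R * 'rV[R]_3 => u z.1 z.2 0 i) d.1 d.2.
  move=> i; have [d1 [d2 H]] := Ck_closure2_derivatives (Ck_closure_coord i (su 2)).
  by exists (d1, d2).
by exists (fun i => (d i).1), (fun i => (d i).2).
Qed.

Theorem theorem1p1 (R : realType) (u0 : 'rV[R]_3 -> 'rV[R]_3)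
    (Fu0 : slip_family u0) :
  [/\ Cinfty_closure (@Omega R) u0,
      forall x : 'rV[R]_3, Omega x -> div u0 x = 0,
      zero_flux u0,
      vorticity_bc u0 &
      forall (T : R) (u : R -> 'rV[R]_3 -> 'rV[R]_3) (p : R -> 'rV[R]_3 -> R),
        0 < T -> euler_solution u0 T u p ->
        exists2 t0 : R, 0 < t0 <= T &
          forall t : R, 0 < t <= t0 -> ~ vorticity_bc (u t)].
Proof.
have [h [g [Hh Hg Hu]]] := Fu0.
pose U := slip_extension h u0.
have HU k i : smooth_on k setT (fun x => U x 0 i) := extension_smooth Hh Hg Hu k i.
have UE x : enorm x <= 1 -> U x = u0 x by exact: (extension_eq Hh Hu).
have oO := @Omega_open R.
have dUE (x : 'rV[R]_3) i j : Omega x ->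
    partial j (fun y => u0 y 0 i) x = partial j (fun y => U y 0 i) x.
  move=> Ox; apply: near_eq_derive; apply: (near_open oO Ox) => y Oy.
  by rewrite UE// ltW.
have Uspin (x : 'rV[R]_3) i : Gamma x -> \sum_(k < 3) spin U i k x * x 0 k = 0.
  exact: (extension_spin_normal Hh Hg Hu).
split.
- move=> k; apply: smooth_on_Ck_closure oO (HU k) _ => x.
  by rewrite closure_Omega => /UE.
- move=> x Ox; rewrite -[RHS](extension_div0 Hh Hg Hu x).
  by apply: eq_bigr => i _; exact: dUE.
- by move=> x x1; rewrite -UE ?x1// (extension_orthogonal Hh Hu).
- move=> x x1; apply/rowP => i; rewrite [RHS]mxE.
  rewrite (vorticity_bcP (S := spin U) x1) ?Uspin// => [j k y Oy|j k y|j k].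
  + by rewrite /spin !dUE.
  + exact: spin_antisym.
  + have s1 l w : smooth_on 0 setT ('D_w (fun y => U y 0 l)) := (HU 1 l).2 w.
    have c : {for x, continuous (spin U j k)}.
      apply: differentiable_continuous.
      exact: (differentiableB (smooth_on_diff (s1 j _) I) (smooth_on_diff (s1 k _) I)).
    by apply: cvg_within_filter; exact: c.
move=> T u p T0 [su Hp HeD H0 _].
have He (t : R) x : 0 < t < T -> Omega x ->
    'D_1 (fun s => u s x) t + advect (u t) (u t) x + grad (p t) x = 0.
  by move=> tI Ox; have [] := HeD t x tI Ox.
have Hi x : Omega x -> u 0 x = U x by move=> Ox; rewrite H0// UE// ltW.
have [d1 [d2 J]] := choose_jets su.
have [x x1 [i K0]] := extension_twist Hh Hg Hu.
have xle : enorm x <= 1 by rewrite x1.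
pose S j k z := d1 j (space_dir R k) z - d1 k (space_dir R j) z.
(* On the line above [x], [f] is component [i] of the vorticity times the normal; [f'] is its time
   derivative and [L] the value of [f'] at time zero. *)
pose f z := \sum_(k < 3) S i k z * x 0 k.
pose f' z := \sum_(k < 3) spin_rate d2 i k z * x 0 k.
pose L := 2 * \sum_(k < 3) spin U i k x * U x 0 k.
have f0 : f (0, x) = 0.
  rewrite -[RHS](Uspin x i x1); apply: eq_bigr => k _; congr (_ * _).
  by rewrite /S !(initial_gradient T0 J HU Hi _ _ xle).
have f'0 : f' (0, x) = L.
  apply: (initial_spin_rate T0 J Hp He HU Hi) => //.
  - exact: (extension_orthogonal Hh Hu).
  - exact: (extension_transpose Hh Hg Hu).
  - exact: (extension_ray Hh Hg Hu).
have L0 : L != 0 by rewrite mulf_neq0.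
(* With the tolerance [|L| / 2], a zero of [f] at a time [t > 0] would give
   [t * |L| <= t * (|L| / 2)]. *)
have e0 : 0 < `|L| / 2 by rewrite divr_gt0// normr_gt0.
have cS j k : {within closure (cylinder T), continuous (S j k)}.
  have [_ c1 _ _ _] := J j; have [_ c1' _ _ _] := J k.
  by apply: within_continuousD; [exact: c1|apply: within_continuousN; exact: c1'].
have cf : {within closure (cylinder T), continuous f}.
  apply: within_continuous_sum => k.
  by apply: within_continuousM; [exact: cS|exact: within_continuous_cst].
have cf' : {within closure (cylinder T), continuous f'}.
  have [_ _ c2 _ _] := J i.
  apply: within_continuous_sum => k; have [_ _ c2' _ _] := J k.
  apply: within_continuousM; last exact: within_continuous_cst.
  by apply: within_continuousD; [exact: c2|apply: within_continuousN; exact: c2'].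
have df z : cylinder T z -> is_derive z (time_dir R) f (f' z).
  move=> Cz; have [_ _ _ _ D2] := J i.
  have dk k : is_derive z (time_dir R) (fun y => S i k y * x 0 k)
      (spin_rate d2 i k z * x 0 k).
    have [_ _ _ _ D2'] := J k.
    have dS := is_derive_add (D2 (space_dir R k) (time_dir R) z Cz)
      (is_derive_opp (D2' (space_dir R i) (time_dir R) z Cz)).
    apply: (is_derive_eq (is_derive_mul dS (is_derive_const (x 0 k) z (time_dir R)))).
    by rewrite mulr0 addr0.
  have d := is_derive_add (is_derive_add (dk 0) (dk 1)) (dk 2%:R).
  have -> : f = fun y => S i 0 y * x 0 0 + S i 1 y * x 0 1 + S i 2%:R y * x 0 2%:R.
    by apply/funext => y; rewrite /f sum3.
  by rewrite /f' sum3.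
have n : nbhs ((0, x) : R * 'rV[R]_3)
    (fun z => closure (cylinder T) z -> `|f' (0, x) - f' z| <= `|L| / 2).
  have zT : 0 <= (0 : R) < T by rewrite lexx.
  move/subspace_continuousP/(_ _ (closure_cylinder zT xle)) : cf'.
  by move=> /cvgrPdist_le/(_ _ e0).
(* One direction pushes the time segment above [x] into the open cylinder, the other runs along
   it. *)
have [s0 s00 P] := near_parallelogram ((1, - x) : R * 'rV[R]_3) (time_dir R) n.
(* The bound 1 keeps the contraction factor [1 - l] positive, and [T / 4] keeps the total time
   [l + a] below [T]. *)
pose m := Num.min s0 (Num.min 1 (T / 4)).
have m0 : 0 < m by rewrite !lt_min s00 ltr01 divr_gt0.
have [ms0 m1 mT] : [/\ m <= s0, m <= 1 & m <= T / 4].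
  by rewrite /m !ge_min !lexx !orbT.
exists m; first by rewrite m0; lra.
move=> t /andP[t0 tm] Vt.
have tI : 0 < t < T by rewrite t0; lra.
(* If the slip condition held at time [t], its component [i] at [x] would be this value. *)
have ft0 : f (t, x) = 0.
  have := congr1 (fun w : 'rV[R]_3 => w 0 i) (Vt x x1); rewrite [RHS]mxE.
  rewrite (vorticity_bcP (S := fun j k y => S j k (t, y)) x1) => [//|j k y Oy|j k y|j k].
  - have Cy : cylinder T (t, y) by apply/cylinderP.
    rewrite /spin /S; have [_ <-] := velocity_space J j k Cy.
    by have [_ <-] := velocity_space J k j Cy.
  - by rewrite /S opprB.
  - exact: slice_cvg (cS j k) tI xle.
(* The segment above [x] lies on the lateral boundary, so the estimate is obtained on its inward
   translates. *)
have : `|f ((0, x) + t *: time_dir R) - f (0, x) - t * L| <= t * (`|L| / 2).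
  apply: (segment_estimate (f' := f') (w := ((1, - x) : R * 'rV[R]_3)) (l0 := m) cf) => //.
  move=> l a /andP[l0 lm] /andP[a0 at_].
  have lI : 0 <= l <= s0 by rewrite ltW//=; lra.
  have aI : 0 <= a <= s0 by rewrite a0/=; lra.
  have Cz : cylinder T ((0, x) + l *: ((1, - x) : R * 'rV[R]_3) + a *: time_dir R).
    rewrite inward_rayE.
    have -> : (0 + l, (1 - l) *: x) + a *: time_dir R = (l + a, (1 - l) *: x).
      by rewrite [LHS]surjective_pairing/= add0r scaler0 addr0 [a *: 1]mulr1.
    apply/cylinderP; split; first by apply/andP; split; lra.
    by apply: enorm_shrink => //; rewrite l0; lra.
  split => //; first exact: df.
  rewrite -f'0 distrC f'0; have := P l a lI aI (subset_closure Cz).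
  by rewrite f'0.
have -> : (0, x) + t *: time_dir R = (t, x).
  by rewrite [LHS]surjective_pairing/= add0r scaler0 addr0 [t *: 1]mulr1.
rewrite ft0 f0 subrr sub0r normrN normrM gtr0_norm// ler_pM2l//.
have : 0 < `|L| by rewrite normr_gt0.
by move: `|L| => l l0 l2; lra.
Qed.
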